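(* Let $\mathcal{A}$ be a unital Banach algebra, let $I$ be a non-empty index set, and let $P$ be a regular square matrix over $\mathcal{A}$, indexed by $I\times I$, all of whose non-zero entries are invertible and with $\|P\|_\infty=\sup\{\|P_{ji}\|: j,i\in I\}\le 1$. Suppose that the $\ell^1$-Munn algebra $LM(\mathcal{A},P)$ has a bounded approximate identity. Then: (1) $\mathcal{A}$ is bounded $\omega^*$-approximately weakly amenable if and only if $LM(\mathcal{A},P)$ is bounded $\omega^*$-approximately weakly amenable; (2) $\mathcal{A}$ is bounded $\omega^*$-approximately cyclic amenable if and only if $LM(\mathcal{A},P)$ is bounded $\omega^*$-approximately cyclic amenable.
   Context: In general, for index sets $I,J$ and a $J\times I$ sandwich matrix $P$ over $\mathcal{A}$ (non-zero entries invertible, $\|P\|_\infty\le 1$), $LM(\mathcal{A},P)$ is the Banach space $\ell^1(I\times J,\mathcal{A})$ of all $I\times J$ matrices $X$ over $\mathcal{A}$ with $\|X\|_1=\sum_{i,j}\|X_{ij}\|<\infty$, made into a Banach algebra by the product $X\circ Y=XPY$. $P$ is square if the index sets $I$ and $J$ are equal, and regular if every row and every column of $P$ contains at least one non-zero entry. For a Banach algebra $\mathcal{C}$, the dual $\mathcal{C}^*$ is a Banach $\mathcal{C}$-bimodule via $\langle a\cdot f,b\rangle=\langle f,ba\rangle$, $\langle f\cdot a,b\rangle=\langle f,ab\rangle$; for $x\in\mathcal{C}^*$, $\mathrm{ad}_x:\mathcal{C}\to\mathcal{C}^*$ is $\mathrm{ad}_x(a)=a\cdot x-x\cdot a$. A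 derivation $D:\mathcal{C}\to\mathcal{C}^*$ is a bounded linear map with $D(ab)=D(a)\cdot b+a\cdot D(b)$; it is cyclic if $\langle D(a),b\rangle+\langle D(b),a\rangle=0$ for all $a,b\in\mathcal{C}$. $\mathcal{C}$ is bounded $\omega^*$-approximately weakly [resp. cyclic] amenable if for every continuous derivation [resp. every cyclic continuous derivation] $D:\mathcal{C}\to\mathcal{C}^*$ there is a net $(x_\alpha)$ in $\mathcal{C}^*$ such that the net $(\mathrm{ad}_{x_\alpha})$ is norm bounded in $B(\mathcal{C},\mathcal{C}^* )$ and $D(a)=\omega^*\text{-}\lim_\alpha \mathrm{ad}_{x_\alpha}(a)$ (weak-* limit in $\mathcal{C}^*$) for all $a\in\mathcal{C}$. *)

(* Defs.v *)
From HB Require Import structures.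
From mathcomp Require Import all_boot all_order all_algebra finmap complex.
From mathcomp Require Import boolp classical_sets functions cardinality fsbigop.
From mathcomp Require Import reals ereal topology normedtype sequences esum.
From mathcomp.analysis.showcase Require summability.

Set Implicit Arguments.
Unset Strict Implicit.
Unset Printing Implicit Defensive.
Import Order.TTheory GRing.Theory Num.Theory.
Import numFieldNormedType.Exports.
Local Open Scope classical_set_scope.
Local Open Scope ring_scope.
Local Open Scope complex_scope.

(* Scalars are the complex numbers R[i], so library norms take values in R[i];
   rnorm is the same norm read in R. *)
Definition rnorm (R : realType) (V : normedModType R[i]) (v : V) : R :=
  complex.Re `|v|.
Arguments rnorm {R V} v.

Section rnorm_theory.
Context {R : realType}.
Implicit Types V : normedModType R[i].

Lemma lecR (x y : R) : (x%:C <= y%:C) = (x <= y).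
Proof. by rewrite lecE /= eqxx. Qed.

Lemma ltcR (x y : R) : (x%:C < y%:C) = (x < y).
Proof. by rewrite ltcE /= eqxx. Qed.

Lemma gt0_cR (e : R[i]) : 0 < e -> exists2 r : R, 0 < r & e = r%:C.
Proof.
move=> e0; exists (complex.Re e); last by rewrite RRe_real// gtr0_real.
by rewrite -ltcR RRe_real// gtr0_real.
Qed.

Lemma rnormE V (v : V) : `|v| = (rnorm v)%:C.
Proof. by rewrite /rnorm RRe_real ?normr_real. Qed.

Lemma rnorm_ge0 V (v : V) : 0 <= rnorm v.
Proof. rewrite -lecR -rnormE; exact: normr_ge0. Qed.

Lemma rnorm0 V : rnorm (0 : V) = 0.
Proof. by rewrite /rnorm normr0. Qed.

Lemma rnorm_eq0 V (v : V) : rnorm v = 0 -> v = 0.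
Proof. by move=> v0; apply/normr0_eq0; rewrite rnormE v0. Qed.

Lemma rnormN V (v : V) : rnorm (- v) = rnorm v.
Proof. by rewrite /rnorm normrN. Qed.

Lemma rnormB V (v w : V) : rnorm (v - w) = rnorm (w - v).
Proof. by rewrite -rnormN opprB. Qed.

Lemma rnormD V (v w : V) : rnorm (v + w) <= rnorm v + rnorm w.
Proof. by rewrite -lecR rmorphD/= -!rnormE ler_normD. Qed.

Lemma rnormZ V (k : R[i]) (v : V) :
  rnorm (k *: v) = rnorm (k : R[i]^o) * rnorm v.
Proof. by apply: complexI; rewrite rmorphM/= -!rnormE normrZ. Qed.

Lemma rnorm_sum V (T : Type) (s : seq T) (f : T -> V) :
  rnorm (\sum_(t <- s) f t) <= \sum_(t <- s) rnorm (f t).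
Proof.
elim/big_ind2: _ => //; first by rewrite rnorm0.
by move=> v x w y vx wy; rewrite (le_trans (rnormD _ _))// lerD.
Qed.

Lemma cvg_rnormP V (T : Type) (F : set_system T) (FF : Filter F)
    (f : T -> V) (l : V) :
  f @ F --> l <->
  (forall e : R, 0 < e -> \forall t \near F, rnorm (l - f t) <= e).
Proof.
split=> [/cvgrPdist_le h e e0|h].
  have /h : 0 < e%:C by rewrite ltcR.
  by apply: filterS => t; rewrite rnormE lecR.
apply/cvgrPdist_le => _ /gt0_cR[e e0 ->].
by apply: filterS (h _ e0) => t; rewrite rnormE lecR.
Qed.

Lemma cauchy_rnormP V (F : set_system V) (FF : ProperFilter F) :
  cauchy F <->
  (forall e : R, 0 < e -> exists v, \forall w \near F, rnorm (v - w) <= e).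
Proof.
split=> [/cauchyP h e e0|h].
  have /h[v Fv] : 0 < e%:C by rewrite ltcR.
  exists v; apply: filterS Fv => w.
  by rewrite -ball_normE/= rnormE ltcR => /ltW.
apply/cauchyP => _ /gt0_cR[e e0 ->].
have /h[v Fv] : 0 < e / 2 by rewrite divr_gt0.
exists v; apply: filterS Fv => w vw.
by rewrite -ball_normE/= rnormE ltcR (le_lt_trans vw)// ltr_pdivrMr// ltr_pMr// ltr1n.
Qed.

End rnorm_theory.

Section bounded_operator.
Context {R : realType}.
Implicit Types V W : normedModType R[i].

Definition is_bop V W : {pred V -> W} :=
  [pred f | `[< linear f /\ continuous f >]].

Arguments is_bop V W : clear implicits.

Lemma is_bopP V W (f : V -> W) :
  reflect (linear f /\ exists M : R, forall v, rnorm (f v) <= M * rnorm v)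
          (f \in is_bop V W).
Proof.
apply: (iffP (asboolP _)) => -[lf hf]; split=> //.
  pose g : {linear V -> W} := HB.pack f (GRing.isLinear.Build _ _ _ _ f lf).
  have /linear_boundedP : bounded_near g (nbhs 0).
    exact/linear_bounded_continuous.
  move=> /pinfty_ex_gt0[_ /gt0_cR[M M0 ->] hM]; exists M => v.
  by have := hM v; rewrite !rnormE -rmorphM lecR.
pose g : {linear V -> W} := HB.pack f (GRing.isLinear.Build _ _ _ _ f lf).
case: hf => M hM; apply: (@bounded_linear_continuous _ _ _ g).
apply/linear_boundedP; exists M%:C; split; first by rewrite complex_real.
move=> K MK v; rewrite (le_trans _ (ler_wpM2r _ (ltW MK)))//.
by rewrite !rnormE -rmorphM lecR.
Qed.

Lemma is_bop_submod V W : submod_closed (is_bop V W).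
Proof.
split=> [|k f g /is_bopP[lf [M hM]] /is_bopP[lg [N hN]]]; apply/is_bopP.
  split=> [a u v|]; first by rewrite /= scaler0 addr0.
  by exists 0 => v; rewrite /= rnorm0 mul0r.
split=> [a u v|].
  rewrite /= -[LHS]/(k *: f _ + g _) -[X in _ = _ *: X + _]/(k *: f _ + g _).
  rewrite -[X in _ = _ + X]/(k *: f _ + g _).
  by rewrite lf lg !scalerDr !scalerA mulrC addrACA.
exists (rnorm (k : R[i]^o) * M + N) => v.
rewrite mulrDl (le_trans (rnormD _ _))// lerD// rnormZ -mulrA.
by rewrite ler_wpM2l ?rnorm_ge0.
Qed.
HB.instance Definition _ V W :=
  GRing.isSubmodClosed.Build R[i] (V -> W) (is_bop V W) (is_bop_submod V W).

Record bop V W := Bop { bop_fun :> V -> W; _ : bop_fun \in is_bop V W }.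
HB.instance Definition _ V W := [isSub for @bop_fun V W].
HB.instance Definition _ V W := [Choice of bop V W by <:].
HB.instance Definition _ V W :=
  [SubChoice_isSubLmodule of bop V W by <:].

Lemma bop_linear V W (f : bop V W) : linear f.
Proof. by case: f => f /= /is_bopP[]. Qed.
HB.instance Definition _ V W (f : bop V W) :=
  GRing.isLinear.Build R[i] V W *:%R (bop_fun f) (bop_linear f).

Lemma bop_continuous V W (f : bop V W) : continuous f.
Proof. by case: f => f /= /asboolP[]. Qed.

Lemma bopP V W (f g : bop V W) : (forall v, f v = g v) -> f = g.
Proof. by move=> fg; apply/val_inj/funext. Qed.

Lemma bop0E V W v : (0 : bop V W) v = 0. Proof. by []. Qed.
Lemma bopDE V W (f g : bop V W) v : (f + g) v = f v + g v. Proof. by []. Qed.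
Lemma bopNE V W (f : bop V W) v : (- f) v = - f v. Proof. by []. Qed.
Lemma bopBE V W (f g : bop V W) v : (f - g) v = f v - g v. Proof. by []. Qed.
Lemma bopZE V W k (f : bop V W) v : (k *: f) v = k *: f v. Proof. by []. Qed.

Definition bop_rnorm V W (f : bop V W) : R :=
  sup [set rnorm (f v) | v in [set v | rnorm v <= 1]].

Let has_sup_bop V W (f : bop V W) :
  has_sup [set rnorm (f v) | v in [set v | rnorm v <= 1]].
Proof.
split; first by exists (rnorm (f 0)), 0 => //=; rewrite rnorm0.
case: f => f /= /is_bopP[_ [M hM]]; exists `|M| => _ [v /= v1 <-].
rewrite (le_trans (hM v))// (le_trans (ler_wpM2r (rnorm_ge0 _) (ler_norm M)))//.
by rewrite ler_piMr.
Qed.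

Lemma bop_rnorm_ge0 V W (f : bop V W) : 0 <= bop_rnorm f.
Proof.
apply: le_trans (rnorm_ge0 (f 0)) _; apply: (sup_upper_bound (has_sup_bop f)).
by exists 0 => //=; rewrite rnorm0.
Qed.

Lemma bop_rnormP V W (f : bop V W) v : rnorm (f v) <= bop_rnorm f * rnorm v.
Proof.
have [v0|vn0] := eqVneq (rnorm v) 0.
  by rewrite (rnorm_eq0 v0) linear0 !rnorm0 mulr0.
have v0 : 0 < rnorm v by rewrite lt_neqAle eq_sym vn0 rnorm_ge0.
rewrite -ler_pdivrMr//; apply: (sup_upper_bound (has_sup_bop f)).
have nk : rnorm ((rnorm v)^-1%:C : R[i]^o) = (rnorm v)^-1.
  apply: complexI; rewrite -rnormE ger0_norm//.
  by rewrite (_ : 0 = 0%:C)// lecR invr_ge0 ltW.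
exists ((rnorm v)^-1%:C *: v) => /=; first by rewrite rnormZ nk mulVf.
by rewrite linearZ/= rnormZ nk mulrC.
Qed.

Lemma bop_rnorm_le V W (f : bop V W) (M : R) : 0 <= M ->
  (forall v, rnorm (f v) <= M * rnorm v) -> bop_rnorm f <= M.
Proof.
move=> M0 hM; apply: ge_sup; first by have [] := has_sup_bop f.
by move=> _ [v /= v1 <-]; rewrite (le_trans (hM v))// ler_piMr.
Qed.

Let bop_normD V W (f g : bop V W) :
  (bop_rnorm (f + g))%:C <= (bop_rnorm f)%:C + (bop_rnorm g)%:C.
Proof.
rewrite -rmorphD lecR; apply: bop_rnorm_le.
  by rewrite addr_ge0 ?bop_rnorm_ge0.
by move=> v; rewrite mulrDl (le_trans (rnormD _ _))// lerD ?bop_rnormP.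
Qed.

Let bop_rnormZ_le V W (k : R[i]) (f : bop V W) :
  bop_rnorm (k *: f) <= rnorm (k : R[i]^o) * bop_rnorm f.
Proof.
apply: bop_rnorm_le; first by rewrite mulr_ge0 ?rnorm_ge0 ?bop_rnorm_ge0.
by move=> v; rewrite rnormZ -mulrA ler_wpM2l ?rnorm_ge0 ?bop_rnormP.
Qed.

Let bop_normZ V W (k : R[i]) (f : bop V W) :
  (bop_rnorm (k *: f))%:C = `|k| * (bop_rnorm f)%:C.
Proof.
rewrite (rnormE (k : R[i]^o)) -rmorphM; congr (_%:C).
apply/eqP; rewrite eq_le bop_rnormZ_le/=.
have [->|k0] := eqVneq k 0; first by rewrite rnorm0 mul0r bop_rnorm_ge0.
have := bop_rnormZ_le k^-1 (k *: f); rewrite scalerA mulVf// scale1r.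
move=> /(ler_wpM2l (rnorm_ge0 (k : R[i]^o))); rewrite mulrA -rnormZ.
rewrite [_ *: _]mulfV// => /le_trans; apply.
rewrite (_ : rnorm _ = 1) ?mul1r//.
by apply: complexI; rewrite -rnormE normr1.
Qed.

Let bop_norm_eq0 V W (f : bop V W) : (bop_rnorm f)%:C = 0 -> f = 0.
Proof.
move=> /complexI f0; apply: bopP => v; apply: rnorm_eq0.
by apply/eqP; rewrite eq_le rnorm_ge0 (le_trans (bop_rnormP f v))// f0 mul0r.
Qed.

HB.instance Definition _ V W := Lmodule_isNormed.Build R[i] (bop V W)
  (@bop_normD V W) (@bop_normZ V W) (@bop_norm_eq0 V W).

Lemma rnorm_bopE V W (f : bop V W) : rnorm f = bop_rnorm f.
Proof. by []. Qed.

End bounded_operator.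
Arguments is_bop {R} V W.

(* MathComp rings are unital, hence a separate structure for Banach algebras
   without a unit *)
HB.mixin Record CompleteNormedModule_isBanachAlg (K : numFieldType) A
    & CompleteNormedModule K A := {
  bmul : A -> A -> A;
  bmulA : associative bmul;
  bmulDl : left_distributive bmul +%R;
  bmulDr : right_distributive bmul +%R;
  bmulZl : forall (k : K) (a b : A), bmul (k *: a) b = k *: bmul a b;
  bmulZr : forall (k : K) (a b : A), bmul a (k *: b) = k *: bmul a b;
  ler_norm_bmul : forall a b : A, `|bmul a b| <= `|a| * `|b|
}.

#[short(type="banachAlgType")]
HB.structure Definition BanachAlg (K : numFieldType) :=
  {A of CompleteNormedModule_isBanachAlg K A & CompleteNormedModule K A}.

(* |1| = 1 is not imposed *)
HB.mixin Record BanachAlg_isUnital (K : numFieldType) A & BanachAlg K A := {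
  bone : A;
  bmul1r : left_id bone bmul;
  bmulr1 : right_id bone bmul
}.

#[short(type="unitalBanachAlgType")]
HB.structure Definition UnitalBanachAlg (K : numFieldType) :=
  {A of BanachAlg_isUnital K A & BanachAlg K A}.

Declare Scope banach_scope.
Delimit Scope banach_scope with B.
Notation "a ** b" := (bmul a b) (at level 40, left associativity) : banach_scope.
Local Open Scope banach_scope.

Definition binvertible (K : numFieldType) (A : unitalBanachAlgType K) (a : A) :=
  exists b : A, a ** b = bone /\ b ** a = bone.

Record directedSet := DirectedSet {
  dcarrier :> Type;
  dle : dcarrier -> dcarrier -> Prop;
  dle_refl : forall s, dle s s;
  dle_trans : forall s t u, dle s t -> dle t u -> dle s u;
  dle_directed : forall s t, exists u, dle s u /\ dle t u;
  directed_nonempty : inhabited dcarrier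
}.

(* [x t @[t --> tails T] --> l] is the convergence of the net x to l *)
Definition tails (T : directedSet) : set_system T :=
  filter_from [set: T] (fun s => [set t | dle s t]).
Arguments tails T : clear implicits.

Global Instance tails_filter (T : directedSet) : ProperFilter (tails T).
Proof.
apply: filter_from_proper => [|s _]; last by exists s; exact: dle_refl.
apply: filter_fromT_filter => [|s t]; first by case: (directed_nonempty T).
have [u [su tu]] := dle_directed s t.
by exists u => v /= uv; split; [exact: dle_trans uv|exact: dle_trans uv].
Qed.

Definition has_bai (R : realType) (A : banachAlgType R[i]) : Prop :=
  exists (T : directedSet) (e : T -> A),
    (exists M : R, forall t, `|e t| <= M%:C) /\
    (forall a : A, (e t ** a @[t --> tails T] --> a) /\
                   (a ** e t @[t --> tails T] --> a)).

Definition dual (R : realType) (V : normedModType R[i]) := bop V R[i]^o.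
HB.instance Definition _ (R : realType) (V : normedModType R[i]) :=
  NormedModule.on (dual V).

Section dual_bimodule.
Context {R : realType} {A : banachAlgType R[i]}.
Implicit Types (a b : A) (f x : dual A).

Lemma rnorm_bmul a b : rnorm (a ** b) <= rnorm a * rnorm b.
Proof. by rewrite -lecR rmorphM/= -!rnormE ler_norm_bmul. Qed.

Let lact_fun a f b := f (b ** a).

Let lact_bop a f : lact_fun a f \in is_bop A R[i]^o.
Proof.
apply/is_bopP; split=> [k u v|].
  by rewrite /lact_fun bmulDl bmulZl linearP.
exists (rnorm f * rnorm a) => v; rewrite (le_trans (bop_rnormP _ _))//.
rewrite -mulrA ler_wpM2l ?bop_rnorm_ge0// mulrC; exact: rnorm_bmul.
Qed.

Definition lact a f : dual A := Bop (lact_bop a f).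

Let ract_fun f a b := f (a ** b).

Let ract_bop f a : ract_fun f a \in is_bop A R[i]^o.
Proof.
apply/is_bopP; split=> [k u v|].
  by rewrite /ract_fun bmulDr bmulZr linearP.
exists (rnorm f * rnorm a) => v; rewrite (le_trans (bop_rnormP _ _))//.
by rewrite -mulrA ler_wpM2l ?bop_rnorm_ge0// rnorm_bmul.
Qed.

Definition ract f a : dual A := Bop (ract_bop f a).

Lemma lactE a f b : lact a f b = f (b ** a). Proof. by []. Qed.
Lemma ractE f a b : ract f a b = f (a ** b). Proof. by []. Qed.

Let ad_bop x : (fun a => lact a x - ract x a) \in is_bop A (dual A).
Proof.
apply/is_bopP; split=> [k u v|].
  apply: bopP => b.
  have E c : (lact c x - ract x c) b = x (b ** c) - x (c ** b) by [].
  rewrite [LHS]E -[RHS]/(k *: (lact u x - ract x u) b + (lact v x - ract x v) b).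
  rewrite !E bmulDr bmulDl bmulZr bmulZl !(linearP x) scalerBr.
  by rewrite opprD addrACA.
exists (2 * rnorm x) => a; apply: bop_rnorm_le => [|b].
  by rewrite !mulr_ge0 ?rnorm_ge0.
rewrite bopBE lactE ractE (le_trans (rnormD _ _))// rnormN.
rewrite -!mulrA mulr2n mulrDl !mul1r lerD// (le_trans (bop_rnormP _ _))//.
  by rewrite ler_wpM2l ?bop_rnorm_ge0// mulrC rnorm_bmul.
by rewrite ler_wpM2l ?bop_rnorm_ge0// rnorm_bmul.
Qed.

Definition ad x : bop A (dual A) := Bop (ad_bop x).

Lemma adE x a : ad x a = lact a x - ract x a. Proof. by []. Qed.

Definition derivation (D : bop A (dual A)) : Prop :=
  forall a b, D (a ** b) = ract (D a) b + lact a (D b).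

Definition cyclic_derivation (D : bop A (dual A)) : Prop :=
  forall a b, D a b + D b a = 0.

Definition weak_star_cvg (T : directedSet) (phi : T -> dual A) (f : dual A) :=
  forall b, phi t b @[t --> tails T] --> (f b : R[i]^o).

Definition bounded_wstar_limit_of_inner (D : bop A (dual A)) : Prop :=
  exists (T : directedSet) (x : T -> dual A),
    (exists M : R, forall t, `|ad (x t)| <= M%:C) /\
    (forall a, weak_star_cvg (fun t => ad (x t) a) (D a)).

End dual_bimodule.

Definition bounded_wstar_approx_weakly_amenable (R : realType)
    (A : banachAlgType R[i]) : Prop :=
  forall D : bop A (dual A), derivation D -> bounded_wstar_limit_of_inner D.

Definition bounded_wstar_approx_cyclic_amenable (R : realType)
    (A : banachAlgType R[i]) : Prop :=
  forall D : bop A (dual A), derivation D -> cyclic_derivation D ->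
    bounded_wstar_limit_of_inner D.

(* [summability.sum f] is the limit of the finite partial sums of f along the
   finite sets ordered by inclusion; the lemmas below establish its convergence
   for absolutely summable families. *)

Global Existing Instance summability.totally_filter.

Section unordered_sum.
Context {R : realType}.
Local Open Scope fset_scope.
Local Open Scope ring_scope.

Lemma ler_sum_uniq_sub (T : eqType) (s s' : seq T) (a : T -> R) :
  (forall t, 0 <= a t) -> uniq s -> {subset s <= s'} ->
  \sum_(t <- s) a t <= \sum_(t <- s') a t.
Proof.
move=> a0; elim: s s' => [|x s IH] s' /= => [_ _|/andP[xs us] ss'].
  by rewrite big_nil sumr_ge0.
have xs' : x \in s' by apply: ss'; rewrite inE eqxx.
rewrite big_cons (perm_big _ (perm_to_rem xs')) big_cons/= lerD2l IH// => y ys.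
have : y \in s' by apply: ss'; rewrite inE ys orbT.
rewrite (perm_mem (perm_to_rem xs')) inE => /orP[/eqP yx|//].
by rewrite -yx ys in xs.
Qed.

Definition fsum_le (T : choiceType) (a : T -> R) (M : R) :=
  forall F : {fset T}, \sum_(t <- F) a t <= M.

Lemma fsum_le_ge0 (T : choiceType) (a : T -> R) M : fsum_le a M -> 0 <= M.
Proof. by move=> /(_ fset0); rewrite big_seq_fset0. Qed.

Lemma fsum_le_inj (T U : choiceType) (h : U -> T) (a : T -> R) M :
  injective h -> fsum_le a M -> fsum_le (a \o h) M.
Proof.
move=> hi aM F; rewrite (le_trans _ (aM [fset h u | u in F]))//.
by rewrite big_imfset//= => u v _ _ /hi.
Qed.

Lemma fsum_le_prod (T U : choiceType) (a : T -> R) (b : U -> R) M N :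
  (forall t, 0 <= a t) -> (forall u, 0 <= b u) ->
  fsum_le a M -> fsum_le b N -> fsum_le (fun p => a p.1 * b p.2) (M * N).
Proof.
move=> a0 b0 aM bN F.
pose s := [seq (x, y) | x <- [fset p.1 | p in F], y <- [fset p.2 | p in F]].
apply: (@le_trans _ _ (\sum_(p <- s) a p.1 * b p.2)).
  apply: ler_sum_uniq_sub => [p||[t u] tu]; first by rewrite mulr_ge0.
    exact: fset_uniq.
  apply/allpairsP; exists (t, u) => /=.
  by split=> //; apply/imfsetP; exists (t, u).
rewrite big_allpairs_dep/=; under eq_bigr do rewrite -mulr_sumr.
by rewrite -mulr_suml ler_pM ?sumr_ge0.
Qed.

Lemma fsum_leM (T : choiceType) (a b : T -> R) M :
  (forall t, a t <= b t) -> fsum_le b M -> fsum_le a M.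
Proof. by move=> ab bM F; rewrite (le_trans _ (bM F))// ler_sum. Qed.

Lemma esum_leP (T : choiceType) (a : T -> R) (M : R) :
  (\esum_(t in [set: T]) (a t)%:E <= M%:E)%E <-> fsum_le a M.
Proof.
split=> [aM F|aM].
  rewrite -lee_fin (le_trans _ aM)//; apply: esum_ge; exists [set` F].
    by split => //; exact: finite_fset.
  by rewrite fsbig_finite//= set_fsetK sumEFin.
apply: ge_ereal_sup => _ [X [finX _] <-].
by rewrite fsbig_finite//= sumEFin lee_fin.
Qed.

Lemma partial_sumE (T : choiceType) (V : zmodType) (f : T -> V) (F : {fset T}) :
  summability.partial_sum f F = \sum_(t <- F) f t.
Proof. by rewrite big_seq_fsetE. Qed.

Lemma near_totally (T : choiceType) (F0 : {fset T}) (P : {fset T} -> Prop) :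
  (forall F : {fset T}, F0 `<=` F -> P F) ->
  \forall F \near summability.totally, P F.
Proof. by move=> h; exists F0. Qed.

Lemma rnorm_cvg (V : normedModType R[i]) (T : Type) (F : set_system T)
    {FF : Filter F} (f : T -> V) (l : V) :
  f @ F --> l -> rnorm (f t) @[t --> F] --> rnorm l.
Proof.
move=> /cvg_rnormP fl; apply/cvgrPdist_le => e e0.
apply: filterS (fl _ e0) => t; apply: le_trans.
rewrite ler_norml lerNl opprB !lerBlDr; apply/andP; split.
  by rewrite rnormB (le_trans _ (rnormD _ _))// subrK.
by rewrite (le_trans _ (rnormD _ _))// subrK.
Qed.

Lemma sum_rnorm_lim_le (V : normedModType R[i]) (T U : Type) (F : set_system T)
    {FF : ProperFilter F} (s : seq U) (h : U -> T -> V) (l : U -> V) (M : R) :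
  (forall u, h u @ F --> l u) ->
  (\forall t \near F, \sum_(u <- s) rnorm (h u t) <= M) ->
  \sum_(u <- s) rnorm (l u) <= M.
Proof.
move=> hl; apply: cvgr_to_le.
elim: s => [|u s IH].
  by under eq_fun do rewrite big_nil; rewrite big_nil; exact: cvg_cst.
under eq_fun do rewrite big_cons; rewrite big_cons.
by apply: cvgD IH; apply: rnorm_cvg.
Qed.

Lemma sum_cvg (T : choiceType) (V : completeNormedModType R[i]) (f : T -> V) M :
  fsum_le (rnorm \o f) M ->
  summability.partial_sum f @ summability.totally --> summability.sum f.
Proof.
move=> fM; apply: cauchy_cvg; apply/cauchy_rnormP => e e0.
pose S := [set \sum_(t <- F) rnorm (f t) | F in [set: {fset T}]].
have supS : has_sup S.
  split; first by exists (\sum_(t <- fset0) rnorm (f t)), fset0.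
  by exists M => _ [F _ <-]; exact: fM.
have [_ [F0 _ <-] hF0] := sup_adherent e0 supS.
exists (summability.partial_sum f F0); apply: (near_totally (F0 := F0)) => F F0F /=.
have := sup_upper_bound supS.
move=> /(_ (\sum_(t <- F) rnorm (f t)) (ex_intro2 _ _ F I erefl)) FS.
rewrite /= !partial_sumE [X in _ - X](big_fsetID _ (mem F0) F)/=.
rewrite (_ : [fset x in F | x \in F0] = F0); last first.
  by apply/fsetP => t; rewrite !inE/= andb_idl// => /(fsubsetP F0F).
rewrite opprD addNKr rnormN (le_trans (rnorm_sum _ _))//.
have : (\sum_(t <- F0) rnorm (f t) +
    \sum_(t <- [fset x in F | x \notin F0]) rnorm (f t) <= sup S)%R.
  apply: le_trans FS; rewrite [leRHS](big_fsetID _ (mem F0) F)/=.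
  rewrite (_ : [fset x in F | x \in F0] = F0)//.
  by apply/fsetP => t; rewrite !inE/= andb_idl// => /(fsubsetP F0F).
move=> h; move: hF0; rewrite ltrBlDr => /ltW /(le_trans h).
by rewrite lerD2l.
Qed.

Lemma fsum_cvg (T : choiceType) (V : completeNormedModType R[i]) (f : T -> V) M :
  fsum_le (rnorm \o f) M ->
  \sum_(t <- F) f t @[F --> summability.totally] --> summability.sum f.
Proof.
move=> fM; have := sum_cvg fM.
have -> : summability.partial_sum f = (fun F => \sum_(t <- F) f t).
  by apply/funext => F; rewrite partial_sumE.
exact.
Qed.

Lemma rnorm_sum_le (T : choiceType) (V : completeNormedModType R[i])
    (f : T -> V) M :
  fsum_le (rnorm \o f) M -> rnorm (summability.sum f) <= M.
Proof.
move=> fM; apply: (cvgr_to_le (rnorm_cvg (sum_cvg fM))).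
apply: (near_totally (F0 := fset0)) => F _.
by rewrite partial_sumE (le_trans (rnorm_sum _ _))//; exact: fM.
Qed.

Lemma sum_unique (T : choiceType) (V : normedModType R[i]) (f : T -> V) (l : V) :
  summability.partial_sum f @ summability.totally --> l ->
  summability.sum f = l.
Proof. exact: cvg_lim. Qed.

Lemma sumD (T : choiceType) (V : completeNormedModType R[i]) (f g : T -> V) M N :
  fsum_le (rnorm \o f) M -> fsum_le (rnorm \o g) N ->
  summability.sum (fun t => f t + g t)%R =
  (summability.sum f + summability.sum g)%R.
Proof.
move=> fM gN; apply: sum_unique.
rewrite (_ : summability.partial_sum _ =
  fun F => summability.partial_sum f F + summability.partial_sum g F)%R.
  by apply: cvgD; [exact: sum_cvg fM|exact: sum_cvg gN].
by apply/funext => F; rewrite !partial_sumE big_split.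
Qed.

Lemma sum_additive (T : choiceType) (V W : completeNormedModType R[i])
    (f : T -> V) M (h : V -> W) (C : R) :
  fsum_le (rnorm \o f) M -> h 0 = 0 -> {morph h : u v / u + v} ->
  {morph h : v / - v} -> (forall v, rnorm (h v) <= C * rnorm v) ->
  summability.sum (h \o f) = h (summability.sum f).
Proof.
move=> fM h0 hD hN hC; apply: sum_unique.
have C0 : 0 < `|C| + 1 by rewrite ltr_wpDl.
apply/cvg_rnormP => e e0; have /cvg_rnormP := sum_cvg fM.
move=> /(_ (e / (`|C| + 1))) /(_ (divr_gt0 e0 C0)).
apply: filterS => F; rewrite !partial_sumE => hF.
rewrite -(big_morph h hD h0) -hN -hD (le_trans (hC _))//.
rewrite ler_pdivlMr// in hF.
rewrite (le_trans _ hF)// mulrC ler_wpM2l ?rnorm_ge0//.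
by rewrite (le_trans (ler_norm C))// lerDl.
Qed.

Lemma sum_pair (T U : choiceType) (V : completeNormedModType R[i])
    (f : T * U -> V) M :
  fsum_le (rnorm \o f) M ->
  summability.sum (fun t => summability.sum (fun u => f (t, u))) =
  summability.sum f.
Proof.
move=> fM; apply: sum_unique; apply/cvg_rnormP => e e0.
have /cvg_rnormP/(_ _ e0)[F0 _ hF0] := sum_cvg fM.
apply: (near_totally (F0 := [fset p.1 | p in F0])) => G F0G.
have cG : \sum_(t <- G) \sum_(u <- H) f (t, u) @[H --> summability.totally]
   --> \sum_(t <- G) summability.sum (fun u => f (t, u)).
  elim: (enum_fset G) => [|t s IH].
    by under eq_fun do rewrite big_nil; rewrite big_nil; exact: cvg_cst.
  under eq_fun do rewrite big_cons; rewrite big_cons.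
  apply: cvgD IH.
  apply: (@fsum_cvg _ _ _ M).
  by apply: (@fsum_le_inj _ _ (fun u => (t, u)) _ _ _ fM) => u v [].
rewrite partial_sumE.
apply: (cvgr_to_le (rnorm_cvg (cvgB (cvg_cst (summability.sum f)) cG))).
apply: (near_totally (F0 := [fset p.2 | p in F0])) => H F0H /=.
have := hF0 (G `*` H); rewrite partial_sumE.
rewrite (_ : \sum_(t <- G `*` H) f t = \sum_(t <- G) \sum_(u <- H) f (t, u)).
  apply; apply/fsubsetP => -[t u] tu; rewrite in_fsetM/=.
  rewrite (fsubsetP F0G) ?(fsubsetP F0H)//; apply/imfsetP; exists (t, u) => //.
by rewrite big_imfset2//= => -[? ?] [? ?] _ _ [-> ->].
Qed.

Lemma sum_reindex (T U : choiceType) (V : completeNormedModType R[i])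
    (h : U -> T) (k : T -> U) (f : T -> V) M : cancel h k -> cancel k h ->
  fsum_le (rnorm \o f) M -> summability.sum (f \o h) = summability.sum f.
Proof.
move=> hK kK fM; apply: sum_unique; apply/cvg_rnormP => e e0.
have /cvg_rnormP/(_ _ e0)[F0 _ hF0] := sum_cvg fM.
apply: (near_totally (F0 := [fset k t | t in F0])) => G F0G.
have := hF0 [fset h u | u in G]; rewrite !partial_sumE big_imfset/=; last first.
  by move=> u v _ _ /(can_inj hK).
apply; apply/fsubsetP => t tF0; apply/imfsetP; exists (k t) => //=.
by apply: (fsubsetP F0G); apply/imfsetP; exists t.
Qed.

Lemma sum_exchange (T U : choiceType) (V : completeNormedModType R[i])
    (f : T -> U -> V) M :
  fsum_le (fun p => rnorm (f p.1 p.2)) M ->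
  summability.sum (fun t => summability.sum (f t)) =
  summability.sum (fun u => summability.sum (f^~ u)).
Proof.
move=> fM; rewrite (sum_pair (f := fun p => f p.1 p.2) fM).
have fM' : fsum_le (rnorm \o (fun p : U * T => f p.2 p.1)) M.
  by apply: (@fsum_le_inj _ _ (fun p => (p.2, p.1)) _ _ _ fM) => -[? ?] [? ?] [-> ->].
rewrite (sum_pair fM').
by apply/esym/(sum_reindex (h := fun p => (p.2, p.1)) (k := fun p => (p.2, p.1))
  _ _ fM) => -[].
Qed.

End unordered_sum.

Section l1_space.
Context {R : realType}.
Implicit Types (T : choiceType) (V : completeNormedModType R[i]).

Definition l1_esum T V (f : T -> V) : \bar R :=
  \esum_(t in [set: T]) (rnorm (f t))%:E.

Definition is_l1 T V : {pred T -> V} := [pred f | (l1_esum f < +oo)%E].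
Arguments is_l1 T V : clear implicits.

Let l1_esum_ge0 T V (f : T -> V) : (0 <= l1_esum f)%E.
Proof. by apply: esum_ge0 => t _; rewrite lee_fin rnorm_ge0. Qed.

Lemma is_l1P T V (f : T -> V) :
  (exists M, fsum_le (rnorm \o f) M) <-> f \in is_l1 T V.
Proof.
rewrite inE; split=> [[M /esum_leP fM]|fy].
  exact: le_lt_trans fM (ltry _).
exists (fine (l1_esum f)); apply/esum_leP.
by rewrite fineK ?ge0_fin_numE.
Qed.

Lemma is_l1_submod T V : submod_closed (is_l1 T V).
Proof.
split=> [|k f g /is_l1P[M fM] /is_l1P[N gN]]; apply/is_l1P.
  by exists 0 => F; rewrite big1// => t _ /=; rewrite rnorm0.
exists (rnorm (k : R[i]^o) * M + N) => F /=.
apply: le_trans (ler_sum _ (fun t _ => rnormD (k *: f t) (g t))) _.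
rewrite big_split/=; apply: lerD; last exact: gN.
rewrite (eq_bigr _ (fun t _ => rnormZ k (f t))) -mulr_sumr.
by rewrite ler_wpM2l ?rnorm_ge0//; exact: fM.
Qed.
HB.instance Definition _ T V :=
  GRing.isSubmodClosed.Build R[i] (T -> V) (is_l1 T V) (is_l1_submod T V).

Record l1 T V := L1 { l1_fun :> T -> V; _ : l1_fun \in is_l1 T V }.
HB.instance Definition _ T V := [isSub for @l1_fun T V].
HB.instance Definition _ T V := [Choice of l1 T V by <:].
HB.instance Definition _ T V := [SubChoice_isSubLmodule of l1 T V by <:].

Lemma l1P T V (f g : l1 T V) : (forall t, f t = g t) -> f = g.
Proof. by move=> fg; apply/val_inj/funext. Qed.

Lemma l1DE T V (f g : l1 T V) t : (f + g) t = f t + g t. Proof. by []. Qed.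
Lemma l1BE T V (f g : l1 T V) t : (f - g) t = f t - g t. Proof. by []. Qed.
Lemma l1ZE T V k (f : l1 T V) t : (k *: f) t = k *: f t. Proof. by []. Qed.

Definition l1_rnorm T V (f : l1 T V) : R := fine (l1_esum f).

Lemma l1_rnormP T V (f : l1 T V) : fsum_le (rnorm \o f) (l1_rnorm f).
Proof.
apply/esum_leP; rewrite /l1_rnorm fineK// ge0_fin_numE//.
by case: f => f /= fy; rewrite inE in fy.
Qed.

Lemma l1_rnorm_le T V (f : l1 T V) M : fsum_le (rnorm \o f) M -> l1_rnorm f <= M.
Proof.
move=> fM; rewrite -lee_fin /l1_rnorm fineK; first exact/esum_leP.
by rewrite ge0_fin_numE//; case: f {fM} => f /= fy; rewrite inE in fy.
Qed.

Lemma rnorm_le_l1 T V (f : l1 T V) t : rnorm (f t) <= l1_rnorm f.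
Proof. by have := l1_rnormP f [fset t]%fset; rewrite big_seq_fset1. Qed.

Let l1_normD T V (f g : l1 T V) :
  (l1_rnorm (f + g))%:C <= (l1_rnorm f)%:C + (l1_rnorm g)%:C.
Proof.
rewrite -rmorphD lecR; apply: l1_rnorm_le => F.
apply: le_trans (ler_sum _ (fun t _ => rnormD (f t) (g t))) _.
by rewrite big_split/=; apply: lerD; exact: l1_rnormP.
Qed.

Let l1_rnormZ_le T V (k : R[i]) (f : l1 T V) :
  l1_rnorm (k *: f) <= rnorm (k : R[i]^o) * l1_rnorm f.
Proof.
apply: l1_rnorm_le => F; rewrite (eq_bigr _ (fun t _ => rnormZ k (f t))).
by rewrite -mulr_sumr ler_wpM2l ?rnorm_ge0//; exact: l1_rnormP.
Qed.

Let l1_normZ T V (k : R[i]) (f : l1 T V) :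
  (l1_rnorm (k *: f))%:C = `|k| * (l1_rnorm f)%:C.
Proof.
rewrite (rnormE (k : R[i]^o)) -rmorphM; congr (_%:C).
apply/eqP; rewrite eq_le l1_rnormZ_le/=.
have [->|k0] := eqVneq k 0.
  by rewrite rnorm0 mul0r; exact: fsum_le_ge0 (l1_rnormP _).
have := l1_rnormZ_le k^-1 (k *: f); rewrite scalerA mulVf// scale1r.
move=> /(ler_wpM2l (rnorm_ge0 (k : R[i]^o))); rewrite mulrA -rnormZ.
rewrite [_ *: _]mulfV// => /le_trans; apply.
rewrite (_ : rnorm _ = 1) ?mul1r//.
by apply: complexI; rewrite -rnormE normr1.
Qed.

Let l1_norm_eq0 T V (f : l1 T V) : (l1_rnorm f)%:C = 0 -> f = 0.
Proof.
move=> /complexI f0; apply: l1P => t; apply: rnorm_eq0.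
by apply/eqP; rewrite eq_le rnorm_ge0 -f0 rnorm_le_l1.
Qed.

HB.instance Definition _ T V := Lmodule_isNormed.Build R[i] (l1 T V)
  (@l1_normD T V) (@l1_normZ T V) (@l1_norm_eq0 T V).

Lemma rnorm_l1E T V (f : l1 T V) : rnorm f = l1_rnorm f.
Proof. by []. Qed.

Let l1_complete T V (F : set_system (l1 T V)) :
  ProperFilter F -> cauchy F -> cvg F.
Proof.
move=> FF /cauchy_rnormP cF.
pose ev t (f : l1 T V) := f t.
have evF t : ev t @ F --> lim (ev t @ F).
  apply: cauchy_cvg; apply/cauchy_rnormP => e /cF[f Ff].
  exists (f t); apply: filterS Ff => g; apply: le_trans.
  by rewrite rnorm_l1E -l1BE rnorm_le_l1.
pose g t := lim (ev t @ F).
have gF e : 0 < e -> \forall f \near F, fsum_le (fun t => rnorm (g t - ev t f)) e.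
  move=> e0; have /cF[f0 Ff0] : 0 < e / 2 by rewrite divr_gt0.
  near=> f => G.
  have cfg t : ev t f - ev t h @[h --> F] --> ev t f - g t.
    by apply: cvgB (evF t); exact: cvg_cst.
  under eq_bigr do rewrite rnormB.
  apply: (sum_rnorm_lim_le (h := fun t h => ev t f - ev t h) cfg).
  near=> h; apply: le_trans (l1_rnormP (f - h) G) _.
  rewrite -rnorm_l1E -(subrKA f0) (le_trans (rnormD _ _))//.
  rewrite (splitr e) lerD//; last by near: h.
  by rewrite rnormB; near: f.
have gl1 : g \in is_l1 T V.
  have [f /= fg] := filter_ex (gF 1 ltr01).
  have -> : g = (g - l1_fun f) + l1_fun f by rewrite subrK.
  apply: rpredD.
    by apply/is_l1P; exists 1.
  by case: (f).
apply/cvg_ex; exists (L1 gl1); apply/cvg_rnormP => e /gF.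
by apply: filterS => f fg; rewrite rnorm_l1E; exact: l1_rnorm_le.
Unshelve. all: by end_near. Qed.

HB.instance Definition _ T V :=
  Uniform_isComplete.Build (l1 T V) (@l1_complete T V).

End l1_space.
Arguments is_l1 {R} T V.

Record sandwich (R : realType) (J I : choiceType)
    (A : unitalBanachAlgType R[i]) := Sandwich {
  sw_fun :> J -> I -> A;
  sw_invertible : forall j i, sw_fun j i != 0 -> binvertible (sw_fun j i);
  sw_norm : (ereal_sup [set (rnorm (sw_fun ji.1 ji.2))%:E | ji in [set: J * I]]
             <= 1)%E
}.

Definition sandwich_regular (R : realType) (J I : choiceType)
    (A : unitalBanachAlgType R[i]) (P : sandwich J I A) : Prop :=
  (forall j, exists i, P j i != 0) /\ (forall i, exists j, P j i != 0).

Definition munn (R : realType) (I J : choiceType)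
    (A : unitalBanachAlgType R[i]) (P : sandwich J I A) := l1 (I * J)%type A.

HB.instance Definition _ (R : realType) (I J : choiceType)
    (A : unitalBanachAlgType R[i]) (P : sandwich J I A) :=
  CompleteNormedModule.on (munn P).

Section munn_algebra.
Context {R : realType} {I J : choiceType} {A : unitalBanachAlgType R[i]}.
Variable P : sandwich J I A.
Implicit Types X Y Z : munn P.

Lemma sw_rnorm_le1 j i : rnorm (P j i) <= 1.
Proof.
rewrite -lee_fin; apply: le_trans (sw_norm P).
by apply: ereal_sup_ubound; exists (j, i).
Qed.

(* the (k, l) term of the entry (i, j) of X P Y, ij = (i, j), kl = (k, l) *)
Definition munn_term X Y (ij : I * J) (kl : J * I) : A :=
  X (ij.1, kl.1) ** P kl.1 kl.2 ** Y (kl.2, ij.2).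

Definition munn_mul_fun X Y (ij : I * J) : A :=
  summability.sum (munn_term X Y ij).

Lemma rnorm_munn_term X Y ij kl : rnorm (munn_term X Y ij kl) <=
  rnorm (X (ij.1, kl.1)) * rnorm (Y (kl.2, ij.2)).
Proof.
rewrite /munn_term (le_trans (rnorm_bmul _ _))// ler_wpM2r ?rnorm_ge0//.
by rewrite (le_trans (rnorm_bmul _ _))// ler_piMr ?rnorm_ge0 ?sw_rnorm_le1.
Qed.

Lemma munn_term_sum X Y :
  fsum_le (fun p => rnorm (munn_term X Y p.1 p.2)) (rnorm X * rnorm Y).
Proof.
have XY := fsum_le_prod (fun t => rnorm_ge0 (X t)) (fun t => rnorm_ge0 (Y t))
  (l1_rnormP X) (l1_rnormP Y).
pose h (p : (I * J) * (J * I)) : (I * J) * (I * J) :=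
  ((p.1.1, p.2.1), (p.2.2, p.1.2)).
have hI : injective h.
  by move=> [[? ?] [? ?]] [[? ?] [? ?]] [-> -> -> ->].
apply: fsum_leM (fsum_le_inj hI XY) => p; exact: rnorm_munn_term.
Qed.

Lemma munn_term_sum1 X Y ij :
  fsum_le (rnorm \o munn_term X Y ij) (rnorm X * rnorm Y).
Proof.
have hI : injective (fun kl : J * I => (ij, kl)) by move=> ? ? [].
exact: fsum_le_inj hI (munn_term_sum X Y).
Qed.

Lemma munn_mul_sum X Y :
  fsum_le (rnorm \o munn_mul_fun X Y) (rnorm X * rnorm Y).
Proof.
move=> F; apply: (sum_rnorm_lim_le (F := summability.totally)
  (h := fun ij (G : {fset J * I}) => \sum_(kl <- G) munn_term X Y ij kl)).
  by move=> ij; exact: fsum_cvg (munn_term_sum1 X Y ij).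
apply: (near_totally (F0 := fset0)) => G _.
rewrite (le_trans (ler_sum _ (fun ij _ => rnorm_sum _ _)))//.
apply: le_trans (munn_term_sum X Y (F `*` G)%fset).
by rewrite big_imfset2//= => -[? ?] [? ?] _ _ [-> ->].
Qed.

Let munn_mul_l1 X Y : munn_mul_fun X Y \in is_l1 (I * J)%type A.
Proof. by apply/is_l1P; exists (rnorm X * rnorm Y); exact: munn_mul_sum. Qed.

Definition munn_mul X Y : munn P := L1 (munn_mul_l1 X Y).

End munn_algebra.

Section banach_algebra_theory.
Context {K : numFieldType} {A : banachAlgType K}.
Implicit Types a b : A.

Lemma bmul0l b : 0 ** b = 0 :> A.
Proof. by have := bmulZl 0 (0 : A) b; rewrite !scale0r. Qed.
Lemma bmul0r a : a ** 0 = 0.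
Proof. by have := bmulZr 0 a (0 : A); rewrite !scale0r. Qed.
Lemma bmulNl a b : (- a) ** b = - (a ** b).
Proof. by rewrite -scaleN1r bmulZl scaleN1r. Qed.
Lemma bmulNr a b : a ** (- b) = - (a ** b).
Proof. by rewrite -scaleN1r bmulZr scaleN1r. Qed.

End banach_algebra_theory.

Section sum_bmul.
Context {R : realType} {A : banachAlgType R[i]} {T : choiceType}.
Implicit Types (f : T -> A) (c : A).

Lemma sum_bmulr f c M : fsum_le (rnorm \o f) M ->
  summability.sum f ** c = summability.sum (fun t => f t ** c).
Proof.
move=> fM; apply/esym.
apply: (@sum_additive R T A A f M (fun a => a ** c) (rnorm c) fM).
- exact: bmul0l.
- by move=> u v; exact: bmulDl.
- by move=> u; exact: bmulNl.
- by move=> u; rewrite mulrC; exact: rnorm_bmul.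
Qed.

Lemma sum_bmull f c M : fsum_le (rnorm \o f) M ->
  c ** summability.sum f = summability.sum (fun t => c ** f t).
Proof.
move=> fM; apply/esym.
apply: (@sum_additive R T A A f M (fun a => c ** a) (rnorm c) fM).
- exact: bmul0r.
- by move=> u v; exact: bmulDr.
- by move=> u; exact: bmulNr.
- by move=> u; exact: rnorm_bmul.
Qed.

Lemma sum_scale f (k : R[i]) M : fsum_le (rnorm \o f) M ->
  k *: summability.sum f = summability.sum (fun t => k *: f t).
Proof.
move=> fM; apply/esym.
apply: (@sum_additive R T A A f M (fun a => k *: a) (rnorm (k : R[i]^o)) fM).
- exact: scaler0.
- by move=> u v; exact: scalerDr.
- by move=> u; exact: scalerN.
- by move=> u; rewrite rnormZ.
Qed.

End sum_bmul.

Section munn_banach_algebra.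
Context {R : realType} {I J : choiceType} {A : unitalBanachAlgType R[i]}.
Variable P : sandwich J I A.
Implicit Types X Y Z : munn P.

Let eq_sum (T : choiceType) (f g : T -> A) :
  f =1 g -> summability.sum f = summability.sum g.
Proof. by move=> /funext ->. Qed.

Let mulA : associative (@munn_mul R I J A P).
Proof.
move=> X Y Z; apply: l1P => -[i j] /=.
rewrite /munn_mul_fun /munn_term/=.
pose f (q p : J * I) : A :=
  X (i, q.1) ** P q.1 q.2 ** Y (q.2, p.1) ** P p.1 p.2 ** Z (p.2, j).
transitivity (summability.sum (fun q => summability.sum (f q))).
  apply: eq_sum => q; rewrite (sum_bmull _ (munn_term_sum1 Y Z (q.2, j))).
  by apply: eq_sum => p; rewrite /munn_term /f !bmulA.
rewrite (@sum_exchange _ _ _ _ f (rnorm X * (rnorm Y * rnorm Z))).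
  apply: eq_sum => p; have XYS := munn_term_sum1 X Y (i, p.1).
  rewrite /munn_mul_fun -bmulA (sum_bmulr _ XYS).
  by apply: eq_sum => q; rewrite /munn_term /f !bmulA.
have nY t : 0 <= rnorm (Y t.1) * rnorm (Z t.2) by rewrite mulr_ge0 ?rnorm_ge0.
have YZ := fsum_le_prod (fun t => rnorm_ge0 (Y t)) (fun t => rnorm_ge0 (Z t))
  (l1_rnormP Y) (l1_rnormP Z).
have XYZ := fsum_le_prod (fun t => rnorm_ge0 (X t)) nY (l1_rnormP X) YZ.
pose h (t : (J * I) * (J * I)) : (I * J) * ((I * J) * (I * J)) :=
  ((i, t.1.1), ((t.1.2, t.2.1), (t.2.2, j))).
have hI : injective h.
  by move=> [[? ?] [? ?]] [[? ?] [? ?]] [-> -> -> ->].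
apply: fsum_leM (fsum_le_inj hI XYZ) => -[[k l] [k' l']]; rewrite /f /h /=.
have -> : X (i, k) ** P k l ** Y (l, k') ** P k' l' ** Z (l', j) =
  X (i, k) ** P k l ** (Y (l, k') ** P k' l' ** Z (l', j)) by rewrite !bmulA.
rewrite (le_trans (rnorm_bmul _ _))// ler_pM ?rnorm_ge0//.
  by rewrite (le_trans (rnorm_bmul _ _))// ler_piMr ?rnorm_ge0 ?sw_rnorm_le1.
rewrite (le_trans (rnorm_bmul _ _))// ler_wpM2r ?rnorm_ge0//.
by rewrite (le_trans (rnorm_bmul _ _))// ler_piMr ?rnorm_ge0 ?sw_rnorm_le1.
Qed.

Let mulDl : left_distributive (@munn_mul R I J A P) +%R.
Proof.
move=> X Y Z; apply: l1P => ij; rewrite [RHS]l1DE /= /munn_mul_fun.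
rewrite -(sumD (munn_term_sum1 X Z ij) (munn_term_sum1 Y Z ij)).
by apply: eq_sum => kl; rewrite /munn_term -!bmulDl.
Qed.

Let mulDr : right_distributive (@munn_mul R I J A P) +%R.
Proof.
move=> X Y Z; apply: l1P => ij; rewrite [RHS]l1DE /= /munn_mul_fun.
rewrite -(sumD (munn_term_sum1 X Y ij) (munn_term_sum1 X Z ij)).
by apply: eq_sum => kl; rewrite /munn_term -!bmulDr.
Qed.

Let mulZl (k : R[i]) X Y : munn_mul (k *: X) Y = k *: munn_mul X Y.
Proof.
apply: l1P => ij; rewrite [RHS]l1ZE /= /munn_mul_fun.
rewrite (sum_scale _ (munn_term_sum1 X Y ij)).
by apply: eq_sum => kl; rewrite /munn_term -!bmulZl.
Qed.

Let mulZr (k : R[i]) X Y : munn_mul X (k *: Y) = k *: munn_mul X Y.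
Proof.
apply: l1P => ij; rewrite [RHS]l1ZE /= /munn_mul_fun.
rewrite (sum_scale _ (munn_term_sum1 X Y ij)).
by apply: eq_sum => kl; rewrite /munn_term -!bmulZr.
Qed.

Let norm_mul X Y : `|munn_mul X Y| <= `|X| * `|Y|.
Proof.
rewrite !rnormE -rmorphM lecR; apply: l1_rnorm_le; exact: munn_mul_sum.
Qed.

HB.instance Definition _ := CompleteNormedModule_isBanachAlg.Build R[i] (munn P)
  mulA mulDl mulDr mulZl mulZr norm_mul.

Lemma munn_mulE X Y ij :
  (X ** Y) ij = summability.sum
    (fun kl : J * I => X (ij.1, kl.1) ** P kl.1 kl.2 ** Y (kl.2, ij.2)).
Proof. by []. Qed.

End munn_banach_algebra.

(* Main.v *)
Require Import Defs.
From mathcomp Require Import all_boot all_order all_algebra complex finmap.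
From mathcomp Require Import boolp classical_sets cardinality.
From mathcomp Require Import reals topology normedtype.
From mathcomp.analysis.showcase Require summability.

Set Implicit Arguments.
Unset Strict Implicit.
Unset Printing Implicit Defensive.
Import Order.TTheory GRing.Theory Num.Theory.
Import numFieldNormedType.Exports.
Local Open Scope classical_set_scope.
Local Open Scope ring_scope.
Local Open Scope complex_scope.
Local Open Scope banach_scope.

(** The bounded approximate identity forces the Munn algebra to be a full
    matrix algebra over A, and full matrix algebras are handled by Morita
    equivalence.

    Finiteness.  Let [e t] be a bounded approximate identity of LM(A,P).
    Multiplying it by the matrix with the single entry 1 at (i, j) reads off
    the row j of P (e t), so its diagonal entry (P (e t))_jj tends to 1; but the
    sum over j of the norms of these entries is at most |1| |e t|, because the
    j-th entry only involves the column j of [e t].  A bound on [e t] thus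
    bounds the number of indices ([munn_bai_finite]).  Once the index set is
    finite, the algebra is finitely generated as a left and as a right ideal
    over itself, so [e t] tends to an identity uniformly on bounded sets; it is
    then Cauchy, and its limit E is an identity element ([bai_unit]).  Here E
    is the inverse matrix of P.

    Matrix units.  Write B for LM(A,P) and fix an entry P_ji with inverse c.  The matrices
    supported at (i, j) form a corner, the algebra p B p for the idempotent p
    with the entry c at (i, j), and a |-> a c identifies A with it.  The
    matrices u_k (entry 1 at (k, j)) and v_k (row i equal to c times the row k
    of E) satisfy v_k u_l = 0 for k <> l, v_k u_k = p and sum_k u_k v_k = E, so
    that X |-> (v_k X u_l)_kl is an isomorphism of B onto a matrix algebra
    over A.

    Transfer.  Any derivation d of A into its dual is amplified to B by
    <d^(X), Y> = sum_kl <d(X_kl), Y_lk>; this preserves cyclicity, turns ad_x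
    into ad of x composed with the trace ([amplify_ad]), and restricting it
    along a |-> u_i (a c at (i, j)) v_i gives d back ([amplifyK]).  Conversely, expanding
    D(v_k X) in two ways shows that each derivation D of B is inner up to the
    amplification of its restriction to the corner:
      D = ad_f + amplify (D restricted), with f = sum_k u_k . D(v_k)
    ([derivation_eq_amplify]).  All these operations are finite sums of maps
    D |-> <D(g X), h Y> with g and h bounded, hence continuous for bounded
    pointwise weak-star convergence ([wstar_limit_transfer]), so the
    approximating nets of inner derivations travel in both directions. *)

(** * Bounded operators and transfer of inner derivations *)

Section sums.
Context {K : numFieldType} {A : banachAlgType K} (T : Type).
Implicit Types (s : seq T) (f : T -> A) (a : A).

Lemma bmul_suml s f a : (\sum_(t <- s) f t) ** a = \sum_(t <- s) f t ** a.
Proof. exact: (big_morph (fun b => b ** a) (fun x y => bmulDl x y a) (bmul0l a)). Qed.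

Lemma bmul_sumr s f a : a ** (\sum_(t <- s) f t) = \sum_(t <- s) a ** f t.
Proof. exact: (big_morph (bmul a) (bmulDr a) (bmul0r a)). Qed.

Lemma bmulBl (a b c : A) : (a - b) ** c = a ** c - b ** c.
Proof. by rewrite bmulDl bmulNl. Qed.

Lemma bmulBr (a b c : A) : a ** (b - c) = a ** b - a ** c.
Proof. by rewrite bmulDr bmulNr. Qed.

End sums.

Section operators.
Context {R : realType}.
Implicit Types U V W : normedModType R[i].

Lemma bop_sumE V W (T : Type) (s : seq T) (f : T -> bop V W) v :
  (\sum_(t <- s) f t) v = \sum_(t <- s) f t v.
Proof. exact: (big_morph (fun g : bop V W => g v) (fun g h => bopDE g h v)). Qed.

Lemma bop_sumr V W (T : Type) (s : seq T) (f : bop V W) (v : T -> V) :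
  f (\sum_(t <- s) v t) = \sum_(t <- s) f (v t).
Proof. exact: linear_sum. Qed.

Lemma rnorm_bop_le V W (f : bop V W) v : rnorm (f v) <= rnorm f * rnorm v.
Proof. exact: bop_rnormP. Qed.

Lemma bop_dualDE V (D E : bop V (dual V)) x y : (D + E) x y = D x y + E x y.
Proof. by []. Qed.

Lemma bop_comp_subproof U V W (f : bop V W) (h : bop U V) :
  f \o h \in is_bop U W.
Proof.
apply/is_bopP; split=> [k x y|]; first by rewrite /= !linearP.
exists (rnorm f * rnorm h) => x; rewrite (le_trans (rnorm_bop_le f (h x)))// -mulrA.
by rewrite ler_wpM2l ?rnorm_ge0// rnorm_bop_le.
Qed.

Definition bop_comp U V W (f : bop V W) (h : bop U V) : bop U W :=
  Bop (bop_comp_subproof f h).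

Lemma bop_compE U V W (f : bop V W) (h : bop U V) x : bop_comp f h x = f (h x).
Proof. by []. Qed.

Lemma rnorm_bop_comp U V W (f : bop V W) (h : bop U V) :
  rnorm (bop_comp f h) <= rnorm f * rnorm h.
Proof.
apply: bop_rnorm_le => [|x]; first by rewrite mulr_ge0 ?rnorm_ge0.
rewrite (le_trans (rnorm_bop_le f (h x)))// -mulrA.
by rewrite ler_wpM2l ?rnorm_ge0// rnorm_bop_le.
Qed.

Lemma transfer_subproof V W (g h : bop W V) (D : bop V (dual V)) :
  (fun x => bop_comp (D (g x)) h : dual W) \in is_bop W (dual W).
Proof.
apply/is_bopP; split=> [k x y|].
  by apply: bopP => z; rewrite bop_compE !linearP.
exists (rnorm D * rnorm g * rnorm h) => x.
rewrite (le_trans (rnorm_bop_comp (D (g x)) h))// mulrAC.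
rewrite ler_wpM2r ?rnorm_ge0// -mulrA (le_trans (rnorm_bop_le D (g x)))//.
by rewrite ler_wpM2l ?rnorm_ge0// rnorm_bop_le.
Qed.

(** The one operation used to move maps into the dual between algebras:
    restriction to a subalgebra is the case [g = h], amplification to matrices
    is a sum of such maps over pairs of entries. *)
Definition transfer V W (g h : bop W V) (D : bop V (dual V)) : bop W (dual W) :=
  Bop (transfer_subproof g h D).

Lemma transferE V W (g h : bop W V) (D : bop V (dual V)) x y :
  transfer g h D x y = D (g x) (h y).
Proof. by []. Qed.

Lemma rnorm_transfer V W (g h : bop W V) (D : bop V (dual V)) :
  rnorm (transfer g h D) <= rnorm g * rnorm h * rnorm D.
Proof.
apply: bop_rnorm_le => [|x]; first by rewrite !mulr_ge0 ?rnorm_ge0.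
rewrite (le_trans (rnorm_bop_comp (D (g x)) h))//.
rewrite [rnorm g * _]mulrC -!mulrA [leRHS]mulrC ler_wpM2r ?rnorm_ge0//.
rewrite (le_trans (rnorm_bop_le D (g x)))// mulrCA.
by rewrite ler_wpM2l ?rnorm_ge0// rnorm_bop_le.
Qed.

End operators.

Section inner_derivations.
Context {R : realType}.
Implicit Types A B : banachAlgType R[i].

Lemma ad_val A (x : dual A) a b : ad x a b = x (b ** a) - x (a ** b).
Proof. by []. Qed.

Lemma derivation_val A (D : bop A (dual A)) : derivation D <->
  forall a b c, D (a ** b) c = D a (b ** c) + D b (c ** a).
Proof.
split=> [dD a b c|dD a b]; first by rewrite dD bopDE ractE lactE.
by apply: bopP => c; rewrite dD bopDE ractE lactE.
Qed.

Lemma adD A (x y : dual A) : ad (x + y) = ad x + ad y.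
Proof.
by apply: bopP => a; apply: bopP => b; rewrite !(ad_val, bopDE) opprD addrACA.
Qed.

(** Each transfer is norm continuous in [D] and evaluates [D] at one pair of
    points, so it preserves bounded pointwise weak-star limits. *)
Lemma wstar_limit_transfer A B (S : Type) (s : seq S) (g h : S -> bop B A)
    (t : dual A -> dual B) (f : dual B) (D : bop A (dual A)) :
  (forall x, \sum_(k <- s) transfer (g k) (h k) (ad x) = ad (t x)) ->
  bounded_wstar_limit_of_inner D ->
  bounded_wstar_limit_of_inner
    (ad f + \sum_(k <- s) transfer (g k) (h k) D).
Proof.
move=> tE [T [x [[M xM] xD]]]; exists T, (fun l => f + t (x l)); split.
  exists (rnorm (ad f) + \sum_(k <- s) rnorm (g k) * rnorm (h k) * M) => l.
  rewrite rnormE lecR adD -tE (le_trans (rnormD _ _))// lerD2l.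
  rewrite (le_trans (rnorm_sum _ _))//; apply: ler_sum => k _.
  rewrite (le_trans (rnorm_transfer _ _ _))//.
  rewrite ler_wpM2l ?mulr_ge0 ?rnorm_ge0// -lecR -rnormE; exact: xM.
move=> b c.
have E l : ad (f + t (x l)) b c =
    ad f b c + \sum_(k <- s) ad (x l) (g k b) (h k c).
  by rewrite adD -tE !bopDE !bop_sumE.
have Dbc : (ad f + \sum_(k <- s) transfer (g k) (h k) D) b c =
    ad f b c + \sum_(k <- s) D (g k b) (h k c).
  by rewrite !bopDE !bop_sumE.
rewrite Dbc; under eq_fun do rewrite E.
apply: cvgD; first exact: cvg_cst.
elim: s {tE E Dbc} => [|k s IH].
  by under eq_fun do rewrite big_nil; rewrite big_nil; exact: cvg_cst.
under eq_fun do rewrite big_cons; rewrite big_cons.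
by apply: cvgD IH; exact: xD.
Qed.

Lemma derivation_pullback A B (h : bop A B) (D : bop B (dual B)) :
  (forall a b, h (a ** b) = h a ** h b) ->
  derivation D -> derivation (transfer h h D).
Proof.
move=> hM /derivation_val dD; apply/derivation_val => a b c.
by rewrite !transferE !hM dD.
Qed.

Lemma wstar_limit_pullback A B (h : bop A B) (D : bop B (dual B)) :
  (forall a b, h (a ** b) = h a ** h b) ->
  bounded_wstar_limit_of_inner D ->
  bounded_wstar_limit_of_inner (transfer h h D).
Proof.
move=> hM lD.
have ad0 : ad (0 : dual A) = 0.
  by apply: bopP => a; apply: bopP => b; rewrite ad_val subrr.
have -> : transfer h h D = ad 0 + \sum_(k <- [:: tt]) transfer h h D.
  by rewrite big_seq1 ad0 add0r.
apply: (wstar_limit_transfer (t := fun x => bop_comp x h)) lD => x.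
rewrite big_seq1.
by apply: bopP => a; apply: bopP => b; rewrite transferE !ad_val !bop_compE !hM.
Qed.

End inner_derivations.

(** * Algebras with matrix units over a corner *)

Section two_sided_multiplication.
Context {R : realType} {B : banachAlgType R[i]}.

Lemma two_sided_mul_subproof (v u : B) : (fun X => v ** X ** u) \in is_bop B B.
Proof.
apply/is_bopP; split=> [k X Y|].
  by rewrite bmulDr bmulDl bmulZr bmulZl.
exists (rnorm v * rnorm u) => X; rewrite (le_trans (rnorm_bmul _ _))//.
by rewrite mulrAC ler_wpM2r ?rnorm_ge0// rnorm_bmul.
Qed.

Definition two_sided_mul (v u : B) : bop B B := Bop (two_sided_mul_subproof v u).

End two_sided_multiplication.

(** [iota] and [rho] identify A with a corner of B containing every
    [v k ** X ** u l], and the corner is full: a finite sum of products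
    [u k ** v k] is a right identity of B. *)
Section full_corner.
Context {R : realType} {A B : banachAlgType R[i]} {K : eqType}.
Variables (s : seq K) (u v : K -> B) (iota : bop A B) (rho : bop B A).
Hypothesis iotaM : forall a b, iota (a ** b) = iota a ** iota b.
Hypothesis rhoK : cancel iota rho.
Hypothesis cornerK : forall k l X,
  iota (rho (v k ** X ** u l)) = v k ** X ** u l.
Hypothesis unitr : forall X, X ** (\sum_(k <- s) u k ** v k) = X.

(** The (k, l) coefficient of an element of B viewed as a matrix over A. *)
Definition entry k l : bop B A := bop_comp rho (two_sided_mul (v k) (u l)).

Lemma entryE k l X : entry k l X = rho (v k ** X ** u l).
Proof. by []. Qed.

Let pairs := [seq (k, l) | k <- s, l <- s].

Definition amplify (d : bop A (dual A)) : bop B (dual B) :=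
  \sum_(kl <- pairs) transfer (entry kl.1 kl.2) (entry kl.2 kl.1) d.

Lemma amplifyE d X Y : amplify d X Y =
  \sum_(k <- s) \sum_(l <- s) d (entry k l X) (entry l k Y).
Proof. by rewrite /amplify !bop_sumE big_allpairs_dep. Qed.

Lemma entryM k l X Y :
  entry k l (X ** Y) = \sum_(m <- s) entry k m X ** entry m l Y.
Proof.
rewrite !entryE -[X in _ ** (X ** _)]unitr.
rewrite bmul_sumr !(bmul_suml, bmul_sumr) bop_sumr.
apply: eq_bigr => m _; rewrite !entryE -[RHS]rhoK iotaM !cornerK; congr (rho _).
by rewrite !bmulA.
Qed.

Lemma amplify_derivation d : derivation d -> derivation (amplify d).
Proof.
move=> /derivation_val dd; apply/derivation_val => X Y Z; rewrite !amplifyE.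
transitivity (\sum_(k <- s) \sum_(l <- s) \sum_(m <- s)
    (d (entry k m X) (entry m l Y ** entry l k Z) +
     d (entry m l Y) (entry l k Z ** entry k m X))).
  apply: eq_bigr => k _; apply: eq_bigr => l _.
  rewrite (entryM k l X Y) bop_sumr bop_sumE; apply: eq_bigr => m _.
  exact: dd.
under eq_bigr => k _ do under eq_bigr => l _ do rewrite big_split.
under eq_bigr => k _ do rewrite big_split.
rewrite big_split; congr (_ + _).
  apply: eq_bigr => k _; rewrite exchange_big; apply: eq_bigr => m _.
  by rewrite (entryM m k Y Z) bop_sumr.
rewrite [RHS]exchange_big [LHS]exchange_big; apply: eq_bigr => l _.
rewrite exchange_big; apply: eq_bigr => m _.
by rewrite (entryM l m Z X) bop_sumr.
Qed.

Lemma amplify_cyclic d : cyclic_derivation d -> cyclic_derivation (amplify d).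
Proof.
move=> dc X Y; rewrite !amplifyE [X in _ + X]exchange_big -big_split.
rewrite big1// => k _; rewrite -big_split big1// => l _; exact: dc.
Qed.

(** The functional x composed with the matrix trace. *)
Definition trace_dual (x : dual A) : dual B :=
  \sum_(k <- s) (bop_comp x (entry k k) : dual B).

Lemma trace_dualE x X : trace_dual x X = \sum_(k <- s) x (entry k k X).
Proof. by rewrite bop_sumE. Qed.

(** Both terms of the commutator regroup into traces of products, as for
    tr(YX) - tr(XY). *)
Lemma amplify_ad x : amplify (ad x) = ad (trace_dual x).
Proof.
apply: bopP => X; apply: bopP => Y; rewrite amplifyE ad_val !trace_dualE.
under eq_bigr => k _ do under eq_bigr => l _ do rewrite ad_val.
under eq_bigr => k _ do rewrite sumrB.
rewrite sumrB; congr (_ - _).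
  rewrite exchange_big; apply: eq_bigr => k _.
  by rewrite (entryM k k Y X) bop_sumr.
by apply: eq_bigr => k _; rewrite (entryM k k X Y) bop_sumr.
Qed.

(** The sum over k of D(v_k X)(Y u_k) is computed in two ways: by the
    derivation rule for the product of v_k and X, and by that rule after
    writing v_k X = sum_l (v_k X u_l) v_l.  Comparing the two isolates D X Y. *)
Lemma derivation_eq_amplify (D : bop B (dual B)) : derivation D ->
  D = ad (\sum_(k <- s) lact (u k) (D (v k))) + amplify (transfer iota iota D).
Proof.
move=> /derivation_val dD; apply: bopP => X; apply: bopP => Y.
set f := \sum_(k <- s) _.
have fE Z : f Z = \sum_(k <- s) D (v k) (Z ** u k).
  by rewrite bop_sumE.
have D_left : \sum_(k <- s) D (v k ** X) (Y ** u k) = f (X ** Y) + D X Y.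
  have -> : D X Y = \sum_(k <- s) D X (Y ** (u k ** v k)).
    by rewrite -bop_sumr -bmul_sumr unitr.
  rewrite fE -big_split; apply: eq_bigr => k _.
  by rewrite dD !bmulA.
have D_right : \sum_(k <- s) D (v k ** X) (Y ** u k) =
    amplify (transfer iota iota D) X Y + f (Y ** X).
  transitivity (\sum_(k <- s) \sum_(l <- s)
      (D (v k ** X ** u l) (v l ** Y ** u k) +
       D (v l) (Y ** (u k ** v k) ** X ** u l))).
    apply: eq_bigr => k _; rewrite -[in LHS](unitr (v k ** X)) bmul_sumr.
    rewrite bop_sumr bop_sumE; apply: eq_bigr => l _.
    by rewrite bmulA dD !bmulA.
  under eq_bigr => k _ do rewrite big_split.
  rewrite big_split; congr (_ + _).
    rewrite amplifyE; apply: eq_bigr => k _; apply: eq_bigr => l _.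
    by rewrite transferE !entryE !cornerK.
  rewrite fE exchange_big; apply: eq_bigr => l _.
  by rewrite -bop_sumr -!bmul_suml -bmul_sumr unitr.
rewrite bop_dualDE ad_val.
by rewrite addrAC [f _ + _]addrC -D_right D_left addrAC subrr add0r.
Qed.

Lemma wstar_limit_of_corner (D : bop B (dual B)) : derivation D ->
  bounded_wstar_limit_of_inner (transfer iota iota D) ->
  bounded_wstar_limit_of_inner D.
Proof.
move=> dD lD; rewrite (derivation_eq_amplify dD).
by apply: wstar_limit_transfer lD; exact: amplify_ad.
Qed.

(* From here on the u and v are matrix units up to the corner embedding: the
   products [v k ** u l] with k <> l vanish and [v o ** u o] acts as the identity
   of the corner. *)
Variable o : K.
Hypotheses (s_uniq : uniq s) (o_in : o \in s).
Hypothesis vu_neq : forall k l, k != l -> v k ** u l = 0.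
Hypothesis vu_iota : forall a, v o ** u o ** iota a = iota a.
Hypothesis iota_vu : forall a, iota a ** (v o ** u o) = iota a.

(** [iota] itself need not map into the (o, o) entry; conjugating it by u_o and
    v_o does, and this is what makes amplification invertible. *)
Definition unit_corner : bop A B := bop_comp (two_sided_mul (u o) (v o)) iota.

Lemma unit_cornerE a : unit_corner a = u o ** iota a ** v o.
Proof. by []. Qed.

Lemma unit_cornerM a b : unit_corner (a ** b) = unit_corner a ** unit_corner b.
Proof. by rewrite !unit_cornerE iotaM -{1}(iota_vu a) !bmulA. Qed.

Lemma entry_unit_corner k l a :
  entry k l (unit_corner a) = if (k == o) && (l == o) then a else 0.
Proof.
rewrite entryE unit_cornerE.
have -> : v k ** (u o ** iota a ** v o) ** u l =
    v k ** u o ** iota a ** (v o ** u l) by rewrite !bmulA.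
have [->|ko] /= := eqVneq k o; last first.
  by rewrite vu_neq// !bmul0l linear0.
have [->|lo] := eqVneq l o; first by rewrite vu_iota iota_vu rhoK.
by rewrite (@vu_neq o l) 1?eq_sym// bmul0r linear0.
Qed.

Lemma sum_only (V : nmodType) (F : K -> V) :
  (forall k, k != o -> F k = 0) -> \sum_(k <- s) F k = F o.
Proof.
move=> F0; rewrite (bigD1_seq o)//= big1 ?addr0// => k ko; exact: F0.
Qed.

Lemma amplifyK d : transfer unit_corner unit_corner (amplify d) = d.
Proof.
apply: bopP => a; apply: bopP => b; rewrite transferE amplifyE.
rewrite sum_only => [|k ko].
  rewrite sum_only => [|l lo]; first by rewrite !entry_unit_corner eqxx.
  by rewrite !entry_unit_corner (negbTE lo) andbF linear0.
rewrite big1// => l _.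
by rewrite !entry_unit_corner (negbTE ko) andbF linear0.
Qed.

Lemma weakly_amenable_full_corner :
  bounded_wstar_approx_weakly_amenable A <->
  bounded_wstar_approx_weakly_amenable B.
Proof.
split=> [hA D dD|hB d dd].
  by apply: wstar_limit_of_corner => //; apply: hA; exact: derivation_pullback.
rewrite -(amplifyK d); apply: wstar_limit_pullback; first exact: unit_cornerM.
by apply: hB; exact: amplify_derivation.
Qed.

Lemma cyclic_amenable_full_corner :
  bounded_wstar_approx_cyclic_amenable A <->
  bounded_wstar_approx_cyclic_amenable B.
Proof.
split=> [hA D dD cD|hB d dd cd].
  apply: wstar_limit_of_corner => //; apply: hA; first exact: derivation_pullback.
  by move=> a b; exact: cD.
rewrite -(amplifyK d); apply: wstar_limit_pullback; first exact: unit_cornerM.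
by apply: hB; [exact: amplify_derivation|exact: amplify_cyclic].
Qed.

End full_corner.

(** * From an approximate identity to an identity *)

Section bai_unit.
Context {R : realType} {A : banachAlgType R[i]}.
Variables (T : directedSet) (e : T -> A) (M : R).
Hypothesis e_bounded : forall t, rnorm (e t) <= M.
Hypothesis e_left : forall a, e t ** a @[t --> tails T] --> a.
Hypothesis e_right : forall a, a ** e t @[t --> tails T] --> a.
Context {S : Type}.
Variables (s : seq S) (w z : S -> A) (g h : S -> A -> A).
(* A is finitely generated as a right and as a left ideal over itself, with
   coefficients controlled in norm. *)
Hypothesis left_gen : forall a, a = \sum_(k <- s) w k ** g k a.
Hypothesis right_gen : forall a, a = \sum_(k <- s) h k a ** z k.
Hypothesis g_norm : forall k a, rnorm (g k a) <= rnorm a.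
Hypothesis h_norm : forall k a, rnorm (h k a) <= rnorm a.

Lemma near_sum_rnorm_le (f : S -> T -> A) (l : S -> A) (eps : R) :
  0 < eps -> (forall k, f k t @[t --> tails T] --> l k) ->
  \forall t \near tails T, \sum_(k <- s) rnorm (l k - f k t) <= eps.
Proof.
move=> eps0 fl; elim: s eps eps0 => [|k s' IH] eps eps0.
  by near=> t; rewrite big_nil ltW.
have e20 : 0 < eps / 2 by rewrite divr_gt0.
near=> t; rewrite big_cons (splitr eps) lerD//; near: t; last exact: IH.
by move/cvg_rnormP: (fl k); exact.
Unshelve. all: by end_near. Qed.

(** Convergence on the finitely many generators controls the defect
    a - e_t a = sum_k (w_k - e_t w_k) (g_k a) uniformly in a. *)
Lemma bai_left_uniform (eps : R) : 0 < eps ->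
  \forall t \near tails T, forall a, rnorm (a - e t ** a) <= eps * rnorm a.
Proof.
move=> eps0; have := near_sum_rnorm_le eps0 (fun k => @e_left (w k)).
apply: filterS => t et a; rewrite {1 2}(left_gen a) bmul_sumr -sumrB.
rewrite (le_trans (rnorm_sum _ _))// (le_trans _ (ler_wpM2r (rnorm_ge0 a) et))//.
rewrite mulr_suml; apply: ler_sum => k _; rewrite bmulA -bmulBl.
by rewrite (le_trans (rnorm_bmul _ _))// ler_wpM2l ?rnorm_ge0.
Qed.

Lemma bai_right_uniform (eps : R) : 0 < eps ->
  \forall t \near tails T, forall a, rnorm (a - a ** e t) <= eps * rnorm a.
Proof.
move=> eps0; have := near_sum_rnorm_le eps0 (fun k => @e_right (z k)).
apply: filterS => t et a; rewrite {1 2}(right_gen a) bmul_suml -sumrB.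
rewrite (le_trans (rnorm_sum _ _))// (le_trans _ (ler_wpM2r (rnorm_ge0 a) et))//.
rewrite mulr_suml; apply: ler_sum => k _; rewrite -bmulA -bmulBr.
by rewrite (le_trans (rnorm_bmul _ _))// mulrC ler_wpM2l ?rnorm_ge0.
Qed.

(** e_t - e_t' = (e_t - e_t' e_t) + (e_t' e_t - e_t'), and the two terms are
    small by uniformity on the left and on the right respectively. *)
Lemma bai_cauchy : cauchy (e @ tails T).
Proof.
apply/cauchy_rnormP => eps eps0.
have M0 : 0 < `|M| + 1 by rewrite ltr_wpDl.
pose d := eps / 2 / (`|M| + 1).
have d0 : 0 < d by rewrite !divr_gt0.
have small a t : rnorm a <= d * rnorm (e t) -> rnorm a <= eps / 2.
  move=> /le_trans; apply; rewrite /d mulrAC ler_pdivrMr//.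
  rewrite ler_wpM2l ?divr_ge0 ?ltW//.
  by rewrite (le_lt_trans (e_bounded t))// (le_lt_trans (ler_norm M))// ltrDl.
have [t et] := filter_ex (bai_right_uniform d0).
exists (e t); have := bai_left_uniform d0; apply: filterS => t' et'.
rewrite /= -(subrKA (e t' ** e t)) (splitr eps).
rewrite (le_trans (rnormD _ _))// lerD//; first exact: small (et' _).
by rewrite rnormB; apply: small (et _).
Qed.

Lemma bai_unit : exists E : A, forall a, E ** a = a /\ a ** E = a.
Proof.
have eE : e @ tails T --> lim (e @ tails T) by apply: cauchy_cvg; exact: bai_cauchy.
set E := lim _ in eE.
have mul_cvg (f : A -> A) (a : A) : (forall x, rnorm (f x) <= rnorm x * rnorm a) ->
    (forall x y, f (x - y) = f x - f y) ->
    f (e t) @[t --> tails T] --> f E.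
  move=> fa fB; apply/cvg_rnormP => eps eps0.
  have a0 : 0 < rnorm a + 1 by rewrite ltr_wpDl ?rnorm_ge0.
  move/cvg_rnormP: eE => /(_ _ (divr_gt0 eps0 a0)).
  apply: filterS => t; rewrite ler_pdivlMr// -fB; apply: le_trans.
  by rewrite (le_trans (fa _))// ler_wpM2l ?rnorm_ge0// lerDl.
exists E => a; split.
  apply: (cvg_unique (@norm_hausdorff _ A) _ (@e_left a)).
  apply: (mul_cvg (fun x => x ** a) a) => [x|x y]; first exact: rnorm_bmul.
  exact: bmulBl.
apply: (cvg_unique (@norm_hausdorff _ A) _ (@e_right a)).
apply: (mul_cvg (bmul a) a) => [x|x y]; first by rewrite mulrC; exact: rnorm_bmul.
exact: bmulBr.
Qed.

End bai_unit.

(** * Elementary matrices in Munn algebras *)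

Section l1_single.
Context {R : realType} {T : choiceType} {V : completeNormedModType R[i]}.

Lemma sum_finite_support (f : T -> V) (F : {fset T}) :
  (forall t, t \notin F -> f t = 0) ->
  summability.sum f = \sum_(t <- F) f t.
Proof.
move=> f0; apply: sum_unique; apply/cvg_rnormP => eps eps0.
apply: (near_totally (F0 := F)) => G FG; rewrite partial_sumE.
rewrite (big_fset_incl _ FG) => [|t _ tF]; last exact: f0.
by rewrite subrr rnorm0 ltW.
Qed.

Lemma sumr_fset_delta (F : {fset T}) (t0 : T) (f : T -> R) : (forall t, 0 <= f t) ->
  \sum_(t <- F) (if t == t0 then f t else 0) <= f t0.
Proof.
move=> f0; rewrite -big_mkcond; have [tF|tF] := boolP (t0 \in F).
  rewrite (big_rem t0)//= eqxx big_seq_cond big1 ?addr0// => t.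
  by rewrite mem_rem_uniq// inE andbC; case: eqVneq.
rewrite big_seq_cond big1// => t /andP[tF' /eqP tt0].
by rewrite -tt0 tF' in tF.
Qed.

Lemma l1_single_subproof (t0 : T) (a : V) :
  (fun t => if t == t0 then a else 0) \in is_l1 T V.
Proof.
apply/is_l1P; exists (rnorm a) => F /=.
under eq_bigr do rewrite fun_if rnorm0.
exact: (sumr_fset_delta _ _ (fun=> rnorm_ge0 a)).
Qed.

Definition l1_single t0 a : l1 T V := L1 (l1_single_subproof t0 a).

Lemma l1_singleE t0 a t : l1_single t0 a t = if t == t0 then a else 0.
Proof. by []. Qed.

Lemma rnorm_l1_single t0 a : rnorm (l1_single t0 a) <= rnorm a.
Proof.
rewrite rnorm_l1E; apply: l1_rnorm_le => F /=.
under eq_bigr do rewrite fun_if rnorm0.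
exact: (sumr_fset_delta _ _ (fun=> rnorm_ge0 a)).
Qed.

Lemma l1_single_linear t0 : linear (l1_single t0).
Proof.
move=> k a b; apply: l1P => t; rewrite l1DE l1ZE !l1_singleE.
by case: ifP => // _; rewrite scaler0 addr0.
Qed.

Lemma l1_sumE (S : Type) (s : seq S) (f : S -> l1 T V) t :
  (\sum_(k <- s) f k) t = \sum_(k <- s) f k t.
Proof. exact: (big_morph (fun g : l1 T V => g t) (fun g h => l1DE g h t)). Qed.

Lemma l1_eq_single t0 (f : l1 T V) :
  (forall t, t != t0 -> f t = 0) -> f = l1_single t0 (f t0).
Proof. by move=> f0; apply: l1P => t; rewrite l1_singleE; case: eqVneq => [->|/f0]. Qed.

End l1_single.

Section munn_units.
Context {R : realType} {I J : choiceType} {A : unitalBanachAlgType R[i]}.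
Variable P : sandwich J I A.

Definition munn_unit i j (a : A) : munn P := l1_single (i, j) a.

Lemma munn_unitE i j a ij :
  munn_unit i j a ij = if (ij.1 == i) && (ij.2 == j) then a else 0.
Proof. by case: ij => i' j'; rewrite /munn_unit l1_singleE xpair_eqE. Qed.

Lemma munn_unit_linear i j : linear (munn_unit i j).
Proof. exact: l1_single_linear. Qed.

Lemma munn_unitM i j k l a b :
  munn_unit i j a ** munn_unit k l b = munn_unit i l (a ** P j k ** b).
Proof.
apply: l1P => -[i' l']; rewrite munn_mulE.
rewrite (sum_finite_support (F := [fset (j, k)]%fset)) => [|[j' k']].
  rewrite big_seq_fset1 !munn_unitE/= !eqxx andbT/=.
  by case: eqP => _; case: eqP => _; rewrite ?bmul0l ?bmul0r.
rewrite inE xpair_eqE !munn_unitE /= => /nandP[/negPf ->|/negPf ->].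
  by rewrite andbF !bmul0l.
by rewrite bmul0r.
Qed.

Lemma munn_mul_row0 (X Y : munn P) i :
  (forall j, X (i, j) = 0) -> forall j, (X ** Y) (i, j) = 0.
Proof.
move=> X0 j; rewrite munn_mulE (sum_finite_support (F := fset0)).
  by rewrite big_seq_fset0.
by move=> kl _; rewrite X0 !bmul0l.
Qed.

Lemma munn_mul_col0 (X Y : munn P) j :
  (forall i, Y (i, j) = 0) -> forall i, (X ** Y) (i, j) = 0.
Proof.
move=> Y0 i; rewrite munn_mulE (sum_finite_support (F := fset0)).
  by rewrite big_seq_fset0.
by move=> kl _; rewrite Y0 !bmul0r.
Qed.

(** The entry (i, j) of this product is sum_l P_jl X_lj, which only involves the
    column j of X, and distinct columns contribute separately to the norm. *)
Lemma munn_diag_bound (i : I) (X : munn P) (F : {fset J}) :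
  \sum_(j <- F) rnorm ((munn_unit i j bone ** X) (i, j)) <=
  rnorm (bone : A) * rnorm X.
Proof.
apply: (sum_rnorm_lim_le (F := summability.totally)
  (h := fun j (G : {fset J * I}) =>
    \sum_(kl <- G) munn_term (munn_unit i j bone) X (i, j) kl)).
  move=> j; exact: fsum_cvg (munn_term_sum1 _ _ _).
apply: (near_totally (F0 := fset0)) => G _.
rewrite (le_trans (ler_sum _ (fun j _ => rnorm_sum _ _)))// exchange_big/=.
have swap_inj : injective (fun kl : J * I => (kl.2, kl.1)).
  by move=> [? ?] [? ?] [-> ->].
apply: (@le_trans _ _ (\sum_(kl <- G) rnorm (bone : A) * rnorm (X (kl.2, kl.1)))).
  apply: ler_sum => -[k l] _ /=.
  apply: le_trans (sumr_fset_delta F k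
    (fun j => mulr_ge0 (rnorm_ge0 (bone : A)) (rnorm_ge0 (X (l, j))))).
  apply: ler_sum => j _; rewrite (le_trans (rnorm_munn_term _ _ _ _))//.
  rewrite munn_unitE/= eqxx/= eq_sym.
  by case: ifP => _; rewrite ?rnorm0 ?mul0r.
rewrite -mulr_sumr ler_wpM2l ?rnorm_ge0//.
exact: (fsum_le_inj swap_inj (l1_rnormP X)).
Qed.

(** The diagonal entries above, for X = e_t, all tend to 1 while the sum of
    their norms stays bounded. *)
Lemma munn_bai_finite (i : I) : bone != 0 :> A -> has_bai (munn P) ->
  finite_set [set: J].
Proof.
move=> A1 [T [e [[M eM] e_bai]]].
have {}A1 : 0 < rnorm (bone : A).
  by rewrite lt_neqAle rnorm_ge0 andbT eq_sym; apply: contra_neq A1 => /rnorm_eq0.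
have le_M (F : {fset J}) : \sum_(j <- F) rnorm (bone : A) <= rnorm (bone : A) * M.
  apply: (sum_rnorm_lim_le (F := tails T)
    (h := fun j t => (munn_unit i j bone ** e t) (i, j))) => [j|].
    have [_ /cvg_rnormP cv] := e_bai (munn_unit i j bone).
    apply/cvg_rnormP => eps /cv; apply: filterS => t; apply: le_trans.
    have := rnorm_le_l1 (munn_unit i j bone - munn_unit i j bone ** e t) (i, j).
    by rewrite l1BE munn_unitE !eqxx.
  apply: nearW => t; rewrite (le_trans (munn_diag_bound _ _ _))//.
  by rewrite ler_wpM2l ?rnorm_ge0// -lecR -rnormE.
apply: contrapT => /(infinite_set_fset (Num.truncn M).+1)[F _].
apply/negP; rewrite -ltnNge ltnS.
have := le_M F; rewrite big_const_seq count_predT iter_addr_0 -mulr_natr.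
rewrite ler_pM2l// => FM; have M0 : 0 <= M by apply: le_trans FM.
by rewrite leqNgt truncn_lt_nat// -leNgt.
Qed.

End munn_units.

(** * Finite Munn algebras as matrix algebras *)

Section finite_munn.
Context {R : realType} {I : choiceType} {A : unitalBanachAlgType R[i]}.
Variables (P : sandwich I I A) (s : {fset I}).
Hypothesis s_full : forall i, i \in s.
Variables (i j : I) (c : A).
Hypotheses (Pc : P j i ** c = bone) (cP : c ** P j i = bone).

Local Notation unit_ k l := (@munn_unit R I I A P k l).

Lemma munn_sum_units (X : munn P) :
  X = \sum_(kl <- [seq (k, l) | k <- s, l <- s]) unit_ kl.1 kl.2 (X kl).
Proof.
apply: l1P => -[k l]; rewrite l1_sumE.
rewrite (bigD1_seq (k, l)); first last.
- by apply: allpairs_uniq => [||[? ?] [? ?] _ _ [-> ->]]; rewrite ?fset_uniq.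
- by apply/allpairsP; exists (k, l); rewrite !s_full.
rewrite munn_unitE !eqxx big1 => [|[k' l']]; first exact/esym/addr0.
rewrite munn_unitE/= xpair_eqE [k == _]eq_sym [l == _]eq_sym.
by move=> /negPf ->.
Qed.

(** The generators are the elementary matrices through the invertible entry
    P_ji: a matrix unit at (k, l) factors as (k, j) times (i, l). *)
Lemma munn_has_unit : has_bai (munn P) ->
  exists E : munn P, forall X, E ** X = X /\ X ** E = X.
Proof.
move=> [T [e [[M eM] e_bai]]].
have eM' t : rnorm (e t) <= M by rewrite -lecR -rnormE.
apply: (bai_unit eM' (fun X => (e_bai X).1) (fun X => (e_bai X).2)
  (s := [seq (k, l) | k <- s, l <- s])
  (w := fun kl => unit_ kl.1 j c) (g := fun kl X => unit_ i kl.2 (X kl))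
  (h := fun kl X => unit_ kl.1 j (X kl)) (z := fun kl => unit_ i kl.2 c))
  => [X|X|kl X|kl X].
- rewrite {1}(munn_sum_units X); apply: eq_bigr => kl _.
  by rewrite munn_unitM cP bmul1r.
- rewrite {1}(munn_sum_units X); apply: eq_bigr => kl _.
  by rewrite munn_unitM -bmulA Pc bmulr1.
- by rewrite (le_trans (rnorm_l1_single _ _))// rnorm_le_l1.
- by rewrite (le_trans (rnorm_l1_single _ _))// rnorm_le_l1.
Qed.

Lemma corner_in_subproof :
  (fun a => unit_ i j (a ** c)) \in is_bop A (munn P).
Proof.
apply/is_bopP; split=> [k a b|].
  by rewrite bmulDl bmulZl munn_unit_linear.
exists (rnorm c) => a; rewrite (le_trans (rnorm_l1_single _ _))// mulrC.
exact: rnorm_bmul.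
Qed.

Definition corner_in : bop A (munn P) := Bop corner_in_subproof.

Lemma corner_out_subproof :
  (fun X : munn P => X (i, j) ** P j i) \in is_bop (munn P) A.
Proof.
apply/is_bopP; split=> [k X Y|].
  by rewrite -bmulZl -bmulDl.
exists 1 => X; rewrite (le_trans (rnorm_bmul _ _))// mulrC.
by rewrite ler_pM ?rnorm_ge0// ?sw_rnorm_le1// rnorm_le_l1.
Qed.

Definition corner_out : bop (munn P) A := Bop corner_out_subproof.

Lemma corner_inE a : corner_in a = unit_ i j (a ** c). Proof. by []. Qed.
Lemma corner_outE X : corner_out X = X (i, j) ** P j i. Proof. by []. Qed.

Lemma corner_inM a b : corner_in (a ** b) = corner_in a ** corner_in b.
Proof.
by rewrite !corner_inE munn_unitM -[a ** c ** _]bmulA cP bmulr1 bmulA.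
Qed.

Lemma corner_inK : cancel corner_in corner_out.
Proof.
move=> a; rewrite corner_outE corner_inE munn_unitE !eqxx/=.
by rewrite -bmulA cP bmulr1.
Qed.

Variable E : munn P.
Hypothesis Eunit : forall X, E ** X = X /\ X ** E = X.

(** The row [i] of [right_unit k] is c E_k: right multiplication by P turns it
    into c times a row of E P = 1, so the products of right and left units are
    zero or the idempotent of the corner. *)
Definition left_unit k : munn P := unit_ k j bone.
Definition right_unit k : munn P := \sum_(l <- s) unit_ i l (c ** E (k, l)).

Lemma sum_left_right : \sum_(k <- s) left_unit k ** right_unit k = E.
Proof.
rewrite [RHS]munn_sum_units big_allpairs_dep; apply: eq_bigr => k _.
rewrite bmul_sumr; apply: eq_bigr => l _.
by rewrite munn_unitM bmul1r bmulA Pc bmul1r.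
Qed.

(** An identity of the Munn product is a left inverse of P: this is the entry
    (k, j) of E composed with the elementary matrix at (l, j). *)
Lemma row_unit_mul k l :
  \sum_(m <- s) E (k, m) ** P m l = if k == l then bone else 0.
Proof.
have := congr1 (fun X : munn P => X (k, j)) (Eunit (left_unit l)).1.
rewrite /left_unit munn_unitE eqxx andbT => <-.
rewrite munn_mulE (sum_finite_support (F := [fset (m, l) | m in s]%fset)).
  rewrite big_imfset => [|m m' _ _ [] //].
  by apply: eq_bigr => m _; rewrite munn_unitE !eqxx bmulr1.
move=> [m l'] ml; rewrite munn_unitE eqxx andbT.
have [l'l|] := eqVneq l' l; last by rewrite bmul0r.
by case/negP: ml; apply/imfsetP; exists m; rewrite ?l'l /=.
Qed.

Lemma right_left k l :
  right_unit k ** left_unit l = if k == l then unit_ i j c else 0.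
Proof.
rewrite bmul_suml.
have -> : \sum_(m <- s) unit_ i m (c ** E (k, m)) ** left_unit l =
    unit_ i j (c ** \sum_(m <- s) E (k, m) ** P m l).
  rewrite bmul_sumr.
  rewrite (big_morph (unit_ i j) (id1 := 0) (op1 := +%R)) => [|a b|].
  - by apply: eq_bigr => m _; rewrite munn_unitM bmulr1 -bmulA.
  - by rewrite -[a]scale1r munn_unit_linear !scale1r.
  by apply: l1P => t; rewrite munn_unitE if_same.
rewrite row_unit_mul; case: ifP => _; first by rewrite bmulr1.
by rewrite bmul0r; apply: l1P => t; rewrite munn_unitE if_same.
Qed.

(** The product is supported at the entry (i, j), since its left factor lives on
    the row [i] and its right factor on the column [j]. *)
Lemma corner_outK k l (X : munn P) :
  corner_in (corner_out (right_unit k ** X ** left_unit l)) =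
  right_unit k ** X ** left_unit l.
Proof.
rewrite corner_inE corner_outE -[_ ** c]bmulA Pc bmulr1; apply/esym/l1_eq_single.
move=> [i' j']; rewrite xpair_eqE => /nandP[i'i|j'j].
  apply: munn_mul_row0; apply: munn_mul_row0 => m.
  rewrite l1_sumE big1// => l' _; rewrite munn_unitE/=.
  by rewrite (negPf i'i).
apply: munn_mul_col0 => m; rewrite /left_unit munn_unitE/=.
by rewrite (negPf j'j) andbF.
Qed.

Lemma munn_full_corner :
  (bounded_wstar_approx_weakly_amenable A <->
     bounded_wstar_approx_weakly_amenable (munn P)) /\
  (bounded_wstar_approx_cyclic_amenable A <->
     bounded_wstar_approx_cyclic_amenable (munn P)).
Proof.
have unitr X : X ** (\sum_(k <- s) left_unit k ** right_unit k) = X.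
  by rewrite sum_left_right; have [] := Eunit X.
have vu0 k l : k != l -> right_unit k ** left_unit l = 0.
  by rewrite right_left => /negPf ->.
have vu_in a : right_unit i ** left_unit i ** corner_in a = corner_in a.
  by rewrite right_left eqxx corner_inE munn_unitM cP bmul1r.
have in_vu a : corner_in a ** (right_unit i ** left_unit i) = corner_in a.
  by rewrite right_left eqxx corner_inE munn_unitM -!bmulA (bmulA c) cP bmul1r.
split.
  exact: (weakly_amenable_full_corner corner_inM corner_inK corner_outK unitr
    (fset_uniq s) (s_full i) vu0 vu_in in_vu).
exact: (cyclic_amenable_full_corner corner_inM corner_inK corner_outK unitr
    (fset_uniq s) (s_full i) vu0 vu_in in_vu).
Qed.

End finite_munn.

Theorem theorem3p9 (R : realType) (A : unitalBanachAlgType R[i])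
    (I : choiceType) (I_nonempty : inhabited I) (P : sandwich I I A)
    (P_regular : sandwich_regular P) (LM_bai : has_bai (munn P)) :
  (bounded_wstar_approx_weakly_amenable A <->
     bounded_wstar_approx_weakly_amenable (munn P)) /\
  (bounded_wstar_approx_cyclic_amenable A <->
     bounded_wstar_approx_cyclic_amenable (munn P)).
Proof.
have [j] := I_nonempty; have [i Pji] := P_regular.1 j.
have [c [Pc cP]] := sw_invertible Pji.
have A1 : bone != 0 :> A.
  by apply: contra_neq Pji => A1; rewrite -[P j i]bmulr1 A1 bmul0r.
have /finite_fsetP[s sT] := munn_bai_finite i A1 LM_bai.
have s_full k : k \in s.
  by have : [set: I] k by []; rewrite sT.
have [E Eunit] := munn_has_unit s_full Pc cP LM_bai.
exact: munn_full_corner s_full _ _ _ Pc cP E Eunit.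
Qed.
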